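(* Let $g\in G\bigl(A(\!(t)\!)\bigr)$. (1) If $r(g)>0$, then $\mathrm{res}(g):\mathbb{G}_{a,A}\to G$ is a non-trivial homomorphism of $A$-group schemes. (2) If $r(g)=0$, then $\mathrm{res}(g):\mathbb{G}_{m,A}\to G$ is a non-trivial homomorphism of $A$-group schemes.
   Context: Let $A$ be a commutative ring, $A[[t]]$ the power series ring and $A(\!(t)\!)=A[[t]][t^{-1}]$. For $n\ge1$ put $A[[t^{1/n}]]=A[[t]][y]/(y^n-t)$ and $A(\!(t^{1/n})\!)=A[[t^{1/n}]][t^{-1}]$. Let $A^u=A[u]$ be a polynomial ring. Every $r\in\mathbb{Q}_{\ge0}$ is written $r=m/n$ with $\gcd(m,n)=1$, $n\ge1$ (and $0=0/1$). Put $A_r=A^u[[t^{1/n}]]$ and $\mathcal{A}_r=A^u(\!(t^{1/n})\!)$, and let $j:A_r\to A^u$ be the specialization $t^{1/n}\mapsto0$. For $r\in\mathbb{Q}_{>0}$, let $\sigma_r:A(\!(t)\!)\to\mathcal{A}_r$ be the $t$-adically continuous $A$-algebra homomorphism with $t\mapsto t(1+ut^r)$. Put $\lambda=1+u$ and $A^{u,+}=A[\lambda,\lambda^{-1}]$. Let $\sigma_0:A(\!(t)\!)\to A^{u,+}(\!(t)\!)$ be given by $t\mapsto\lambda t$, and let $j:A^{u,+}[[t]]\to A^{u,+}$ be the specialization $t\mapsto0$. Let $G$ be an affine $A$-group scheme with a closed embedding $G\hookrightarrow\mathrm{SL}_{N,A}$. For a ring map $\sigma$, $\sigma(g)$ denotes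 the image of $g$ under $G(\sigma)$. Index: if $g\in G(A[[t]])$, set $r(g)=-1$. Otherwise $r(g)\in\mathbb{Q}_{\ge0}$ is the infimum in $\mathbb{R}$ of $\{r\in\mathbb{Q}_{>0}\mid g^{-1}\sigma_r(g)\in G(A_r)\}$. Residue: if $r(g)>0$, $\mathrm{res}(g)=j\bigl(g^{-1}\sigma_{r(g)}(g)\bigr)\in G(A[u])$, viewed as an $A$-morphism $\mathbb{G}_{a,A}=\mathrm{Spec}\,A[u]\to G$. If $r(g)=0$, then $g^{-1}\sigma_0(g)\in G(A^{u,+}[[t]])$ and $\mathrm{res}(g)=j\bigl(g^{-1}\sigma_0(g)\bigr)\in G(A[\lambda^{\pm1}])$, viewed as an $A$-morphism $\mathbb{G}_{m,A}=\mathrm{Spec}\,A[\lambda^{\pm1}]\to G$. If $r(g)=-1$, $\mathrm{res}(g)=1$. *)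

(* Defs.v *)
From HB Require Import structures.
From mathcomp Require Import all_boot all_order all_algebra.
From mathcomp Require Import mpoly.
Set Implicit Arguments. Unset Strict Implicit. Unset Printing Implicit Defensive.
Import Order.TTheory GRing.Theory Num.Theory.
Local Open Scope ring_scope.

(* Formal Laurent series  sum_{i>=0} lcoef i * s^(lval + i)  over a type B.  *)
(* Equality of series is the extensional one (coefficientwise, via coefL).   *)
Record lser (B : Type) := LSer { lval : int; lcoef : nat -> B }.

Section LaurentSeries.
Variable B : comNzRingType.
Implicit Types (f g : lser B).

Definition coefL f (j : int) : B :=
  match j - lval f with Posz i => lcoef f i | Negz _ => 0 end.

Definition mkL (v : int) (c : int -> B) : lser B := LSer v (fun i => c (v + i%:Z)).
Definition addL f g : lser B :=
  mkL (Num.min (lval f) (lval g)) (fun j => coefL f j + coefL g j).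
Definition mulL f g : lser B :=
  LSer (lval f + lval g) (fun k => \sum_(i < k.+1) lcoef f i * lcoef g (k - i)%N).
Definition cstL (b : B) : lser B := LSer 0 (fun i => if i == 0%N then b else 0).
Definition zeroL := cstL 0.
Definition oneL := cstL 1.
Definition expL f (k : nat) := iter k (mulL f) oneL.

Definition integralL f : Prop := forall e : int, e < 0 -> coefL f e = 0.
Definition nullL f : Prop := forall e : int, coefL f e = 0.

Definition evalL (n : nat) (p : {mpoly B[n]}) (v : 'I_n -> lser B) : lser B :=
  \big[addL/zeroL]_(m <- msupp p)
     mulL (cstL p@_m) (\big[mulL/oneL]_(k < n) expL (v k) (m k)).

Definition mulML (N : nat) (M M' : 'M[lser B]_N) : 'M[lser B]_N :=
  \matrix_(i, j) \big[addL/zeroL]_(k < N) mulL (M i k) (M' k j).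
End LaurentSeries.

Definition mapL (B C : Type) (phi : B -> C) (f : lser B) : lser C :=
  LSer (lval f) (fun i => phi (lcoef f i)).

Definition binz (k : int) (i : nat) : int :=
  match k with
  | Posz p => ('C(p, i))%:Z
  | Negz p => (-1) ^+ i * ('C(p + i, i))%:Z
  end.

Section GroupScheme.
Variables (A : comNzRingType) (N : nat).

Definition Xmx : 'M[{mpoly A[N * N]}]_N := \matrix_(i, j) 'X_(mxvec_index i j).

(* points of the closed subscheme V(I) of (N x N)-matrices, over an A-algebra R *)
Definition ptsG (I : {mpoly A[N * N]} -> Prop) (R : comAlgType A) (M : 'M[R]_N) : Prop :=
  forall p, I p -> mmap (in_alg R) (fun k => mxvec M 0 k) p = 0.

Definition closed_subgroup_SL (I : {mpoly A[N * N]} -> Prop) : Prop :=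
  I (\det Xmx - 1) /\
  forall R : comAlgType A,
    [/\ ptsG I (1%:M : 'M[R]_N),
        forall M M' : 'M[R]_N, ptsG I M -> ptsG I M' -> ptsG I (M *m M')
      & forall M : 'M[R]_N, ptsG I M -> ptsG I (\adj M)].

Definition ptsGL (I : {mpoly A[N * N]} -> Prop) (g : 'M[lser A]_N) : Prop :=
  forall p, I p -> nullL (evalL p (fun k => mxvec g 0 k)).

(* g lies in G(A[[t]]) (given that it is in G(A((t)))) *)
Definition integralM (B : comNzRingType) (g : 'M[lser B]_N) : Prop :=
  forall i j, integralL (g i j).

(* g^{-1} for g in SL_N(A((t))): the adjugate matrix *)
Definition adjL (g : 'M[lser A]_N) : 'M[lser A]_N :=
  \matrix_(i, j) evalL (\adj Xmx i j) (fun k => mxvec g 0 k).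

(* A((t)) -> A[u]((t^{1/n})), with s = t^{1/n}: t |-> s^n *)
Definition ramL (n : nat) (f : lser A) : lser {poly A} :=
  mkL (lval f * n%:Z)
      (fun j => if j \in dvdz n%:Z then (coefL f (divz j n%:Z))%:P else 0).

(* sigma_r for r = m/n : t |-> t(1 + u t^r), i.e. with s = t^{1/n},
   t^k |-> s^(nk) (1 + u s^m)^k = sum_i binz k i u^i s^(nk + m i).
   Coefficient of s^j : sum over k >= lval f with j - n k = m i, i >= 0. *)
Definition sigmaL (m n : nat) (f : lser A) : lser {poly A} :=
  mkL (lval f * n%:Z) (fun j =>
    let d := j - lval f * n%:Z in
    \sum_(k' < `|d|%N.+1)
      let k := lval f + k'%:Z in
      let e := d - (n * k')%N%:Z in
      if (0 <= e) && (e \in dvdz m%:Z)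
      then ((coefL f k) *~ binz k `|divz e m%:Z|%N)%:P * 'X^(`|divz e m%:Z|%N)
      else 0).

Definition numN (r : rat) : nat := `|numq r|%N.
Definition denN (r : rat) : nat := `|denq r|%N.

Definition hmat (g : 'M[lser A]_N) (r : rat) : 'M[lser {poly A}]_N :=
  mulML (map_mx (ramL (denN r)) (adjL g)) (map_mx (sigmaL (numN r) (denN r)) g).

Definition good (g : 'M[lser A]_N) (r : rat) : Prop := integralM (hmat g r).

(* r(g) = q  for q in Q_{>=0}: g notin G(A[[t]]) and q is the infimum (in R)
   of { r in Q_{>0} | g^{-1} sigma_r(g) in G(A_r) } *)
Definition rindex (g : 'M[lser A]_N) (q : rat) : Prop :=
  ~ integralM g /\
  (forall r : rat, 0 < r -> good g r -> q <= r) /\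
  (forall q' : rat, q < q' -> exists r : rat, [/\ 0 < r, good g r & r < q']).

Definition res_pos (g : 'M[lser A]_N) (r : rat) : 'M[{poly A}]_N :=
  \matrix_(i, j) coefL (hmat g r i j) 0.

(* M : G_a -> G (an element of G(A[u])) is a homomorphism:
   M(u + v) = M(u) M(v) in G(A[u, v]), A[u,v] = {poly {poly A}} with
   u the inner and v the outer variable. *)
Definition Ga_hom (I : {mpoly A[N * N]} -> Prop) (M : 'M[{poly A}]_N) : Prop :=
  ptsG I M /\
  map_mx (fun q => (map_poly polyC q) \Po ('X + ('X)%:P)) M =
    map_mx (fun q => q%:P) M *m map_mx (map_poly polyC) M.

Definition powZ (R : ringType) (x xi : R) (k : int) : R :=
  match k with Posz p => x ^+ p | Negz p => xi ^+ p.+1 end.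

(* sigma_0 : t |-> lambda t, followed by lambda |-> x, for a unit x of an
   A-algebra R (functor-of-points description of A[lambda^{+-1}]) *)
Definition sigma0 (R : comAlgType A) (x xi : R) (f : lser A) : lser R :=
  LSer (lval f) (fun i => (lcoef f i)%:A * powZ x xi (lval f + i%:Z)).

(* value at the R-point x of G_m of res(g) = j(g^{-1} sigma_0(g)) *)
Definition res0 (g : 'M[lser A]_N) (R : comAlgType A) (x xi : R) : 'M[R]_N :=
  \matrix_(i, j)
    coefL (mulML (map_mx (mapL (in_alg R)) (adjL g))
                 (map_mx (sigma0 x xi) g) i j) 0.

(* res(g) : G_m -> G is a non-trivial homomorphism of A-group schemes,
   described on points over all A-algebras R (Yoneda). *)
Definition Gm_hom_nontriv (I : {mpoly A[N * N]} -> Prop) (g : 'M[lser A]_N) : Prop :=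
  [/\ forall (R : comAlgType A) (x xi : R), x * xi = 1 -> ptsG I (res0 g x xi),
      forall (R : comAlgType A) (x xi y yi : R), x * xi = 1 -> y * yi = 1 ->
        res0 g (x * y) (xi * yi) = res0 g x xi *m res0 g y yi
    & exists (R : comAlgType A) (x xi : R), x * xi = 1 /\ res0 g x xi <> 1%:M].

End GroupScheme.

(* Main.v *)
Require Import Defs.
From HB Require Import structures.
From mathcomp Require Import all_boot all_order all_algebra.
From mathcomp Require Import mpoly.
From mathcomp Require boolp.
From mathcomp Require Import zify ring.
Import Order.TTheory GRing.Theory Num.Theory.
Set Implicit Arguments. Unset Strict Implicit. Unset Printing Implicit Defensive.
Local Open Scope ring_scope.

(** Expanding [sigma_r(t^k) = t^k (1 + u t^r)^k] gives
    [g^{-1} sigma_r(g) = \sum_i u^i t^{ir} W_i] with [W_i = g^{-1} D_i(g)], where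
    [D_i] is the (degree-preserving) Hasse derivative [t^k |-> binom(k, i) t^k].
    Hence [r] is good iff every monomial [u^i t^k] of [\sum_i u^i W_i] has weight
    [k + ri >= 0], so a positive index is attained, the residue is the part of
    weight 0, and it is not constant.  Taking parts of weight 0 is compatible with
    sums and products, so the residue lies in [G]; the composition law
    [binom(i, b) W_i = \sum_c W_c E_{i-b-c}(W_b)], [E_e : t^k |-> binom(k-b, e) t^k],
    whose right side has only the term [c = i - b] in weight 0, says that it is
    additive.

    If the index is 0, all the [W_i] are integral.  As the functions [binom(k, i)]
    separate the degrees [k], each coefficient of [t^j lambda^k], [j < 0], of
    [g^{-1} sigma_0(g)] vanishes; reducing the cocycle identity for
    [lambda |-> g^{-1} sigma_0(g)] modulo [t] gives the homomorphism.  If it were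
    trivial, the coefficients of [g] of negative degree would vanish one by one. *)

(** * Finitely supported sums over the integers *)

Definition fin_supp (V : nmodType) (F : int -> V) : Prop :=
  exists s : seq int, forall k, F k != 0 -> k \in s.

(** The list is picked by classical choice, so that [tsum] is a total operation. For infinite
    support it is empty and [tsum] takes the default value 0. *)
Definition fin_supp_seq (V : nmodType) (F : int -> V) : seq int :=
  if boolp.pselect (fin_supp F) is left h then
    undup (projT1 (boolp.cid h)) else [::].

Definition tsum (V : nmodType) (F : int -> V) : V := \sum_(k <- fin_supp_seq F) F k.

Definition zitv (a b : int) : seq int :=
  if a <= b then [seq a + i%:Z | i <- iota 0 (absz (b - a)).+1] else [::].

Lemma mem_zitv (a b k : int) : (k \in zitv a b) = (a <= k <= b).
Proof.
rewrite /zitv; case: ifP => ab; last by rewrite in_nil; lia.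
apply/mapP/idP => [[i]|h]; first by rewrite mem_iota; lia.
by exists (absz (k - a)); rewrite ?mem_iota; lia.
Qed.

Section Tsum.
Context {V : nmodType}.
Implicit Types (F G : int -> V) (s : seq int).

Lemma sum_uniq_supp F s1 s2 : uniq s1 -> uniq s2 ->
  (forall k, F k != 0 -> k \in s1) -> (forall k, F k != 0 -> k \in s2) ->
  \sum_(k <- s1) F k = \sum_(k <- s2) F k.
Proof.
move=> u1 u2 h1 h2.
have e s : \sum_(k <- s) F k = \sum_(k <- [seq k <- s | F k != 0]) F k.
  rewrite big_filter [LHS](bigID (fun k => F k == 0)) /= big1 ?add0r //.
  by move=> i /eqP.
rewrite [LHS]e [RHS]e; apply: perm_big; apply: uniq_perm; rewrite ?filter_uniq //.
by move=> k; rewrite !mem_filter; case: (boolP (F k == 0)) => //= hk; rewrite h1 ?h2.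
Qed.

Lemma tsumE F s : uniq s -> (forall k, F k != 0 -> k \in s) ->
  tsum F = \sum_(k <- s) F k.
Proof.
move=> us hs; rewrite /tsum /fin_supp_seq.
case: boolp.pselect => [h|[]]; last by exists s.
apply: sum_uniq_supp => //; first exact: undup_uniq.
by move=> k hk; rewrite mem_undup; apply: (projT2 (boolp.cid h)).
Qed.

Lemma fin_supp_uniq F : fin_supp F ->
  exists2 s, uniq s & forall k, F k != 0 -> k \in s.
Proof.
by case=> s hs; exists (undup s) => [|k hk]; rewrite ?undup_uniq ?mem_undup ?hs.
Qed.

Lemma eq_tsum F G : F =1 G -> tsum F = tsum G.
Proof. by move=> e; congr tsum; apply: boolp.funext. Qed.

Lemma tsum0 F : (forall k, F k = 0) -> tsum F = 0.
Proof. by move=> h; rewrite /tsum big1. Qed.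

Lemma tsum1 F k0 : (forall k, k != k0 -> F k = 0) -> tsum F = F k0.
Proof.
move=> h; rewrite (@tsumE F [:: k0]) ?big_seq1 // => k; rewrite inE.
by apply: contraNT => /h ->.
Qed.

Lemma fin_supp_itv F (a b : int) : (forall k, k < a -> F k = 0) ->
  (forall k, b < k -> F k = 0) -> fin_supp F.
Proof.
move=> ha hb; exists (zitv a b) => k nz; rewrite mem_zitv.
have ak : a <= k by rewrite leNgt; apply: contraNN nz => /ha/eqP.
have kb : k <= b by rewrite leNgt; apply: contraNN nz => /hb/eqP.
by rewrite ak kb.
Qed.

Lemma tsumD F G : fin_supp F -> fin_supp G ->
  tsum (fun k => F k + G k) = tsum F + tsum G.
Proof.
case=> s hs [s' hs']; have u := undup_uniq (s ++ s').
have sub k : k \notin undup (s ++ s') -> F k = 0 /\ G k = 0.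
  rewrite mem_undup mem_cat negb_or => /andP[ks ks'].
  by split; apply/eqP; [apply: contraNT ks => /hs | apply: contraNT ks' => /hs'].
rewrite !(@tsumE _ (undup (s ++ s'))) ?big_split // => k; apply: contraNT => /sub[e e'];
  by rewrite ?e ?e' ?addr0.
Qed.

(* [h] only needs to be injective: the support of [F] must lie in its image. *)
Lemma tsum_reindex (h : int -> int) F : injective h -> fin_supp F ->
  (forall k, F k != 0 -> exists l, k = h l) -> tsum F = tsum (fun l => F (h l)).
Proof.
move=> ih /fin_supp_uniq [s us hs] him.
pose p k := if boolp.pselect (exists l, k = h l) is left e then projT1 (boolp.cid e) else 0.
have hp k : F k != 0 -> h (p k) = k.
  by move=> /him e; rewrite /p; case: boolp.pselect => // e'; case: boolp.cid.
pose s1 := [seq k <- s | F k != 0].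
have hs1 k : F k != 0 -> k \in s1 by move=> nz; rewrite mem_filter nz hs.
have hps1 : [seq h l | l <- map p s1] = s1.
  rewrite -map_comp -[RHS]map_id; apply/eq_in_map => k; rewrite mem_filter => /andP[nz _] /=.
  exact: hp.
rewrite (@tsumE F s1) ?filter_uniq //.
rewrite (@tsumE _ (map p s1)); first by rewrite -[in LHS]hps1 big_map.
  by rewrite -(map_inj_uniq ih) hps1 filter_uniq.
by move=> l /hs1; rewrite -{1}hps1 (mem_map ih).
Qed.

(** The joint support is asked to lie in one finite box; both iterated sums then become ordinary
    finite sums over that box. *)
Lemma exchange_tsum (F : int -> int -> V) (s1 s2 : seq int) :
  (forall k l, F k l != 0 -> (k \in s1) && (l \in s2)) ->
  tsum (fun k => tsum (F k)) = tsum (fun l => tsum (F^~ l)).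
Proof.
move=> hF; have [u1 u2] := (undup_uniq s1, undup_uniq s2).
have e1 k : tsum (F k) = \sum_(l <- undup s2) F k l.
  by apply: tsumE => // l /hF /andP[_]; rewrite mem_undup.
have e2 l : tsum (F^~ l) = \sum_(k <- undup s1) F k l.
  by apply: tsumE => // k /hF /andP[+ _]; rewrite mem_undup.
rewrite (@tsumE _ (undup s1)) //; last first.
  move=> k; apply: contraNT; rewrite mem_undup => ks; rewrite tsum0 // => l.
  by apply: contraNeq ks => /hF /andP[].
rewrite [RHS](@tsumE _ (undup s2)) //; last first.
  move=> l; apply: contraNT; rewrite mem_undup => ls; rewrite tsum0 // => k.
  by apply: contraNeq ls => /hF /andP[].
by rewrite (eq_bigr _ (fun k _ => e1 k)) (eq_bigr _ (fun l _ => e2 l)) exchange_big.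
Qed.

End Tsum.

Lemma raddf_tsum (V W : nmodType) (f : V -> W) (F : int -> V) :
  f 0 = 0 -> {morph f : x y / x + y} -> fin_supp F ->
  f (tsum F) = tsum (fun k => f (F k)).
Proof.
move=> f0 fD /fin_supp_uniq [s us hs]; rewrite (tsumE us hs) (big_morph f fD f0).
by rewrite (@tsumE _ _ s) // => k; apply: contraNT => /(contraNT (hs k)) /eqP->; rewrite f0.
Qed.

Lemma fin_supp_raddf (V W : nmodType) (f : int -> V -> W) (F : int -> V) :
  (forall k, f k 0 = 0) -> fin_supp F -> fin_supp (fun k => f k (F k)).
Proof.
move=> f0 [s hs]; exists s => k; apply: contraNT.
by move=> /(contraNT (hs k)) /eqP->; rewrite f0.
Qed.

Lemma fin_supp_sum (V : nmodType) (I : Type) (r : seq I) (P : pred I) (F : I -> int -> V) :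
  (forall i, fin_supp (F i)) -> fin_supp (fun k => \sum_(i <- r | P i) F i k).
Proof.
move=> hF; elim: r => [|i r [s hs]]; first by exists [::] => k; rewrite big_nil eqxx.
have [s' hs'] := hF i; exists (s' ++ s) => k; rewrite mem_cat; apply: contraNT.
rewrite negb_or => /andP[/(contraNT (hs' k)) /eqP e /(contraNT (hs k)) /eqP e'].
by rewrite big_cons e e' addr0 if_same.
Qed.

Lemma tsum_sum (V : nmodType) (I : Type) (r : seq I) (P : pred I) (F : I -> int -> V) :
  (forall i, fin_supp (F i)) ->
  tsum (fun k => \sum_(i <- r | P i) F i k) = \sum_(i <- r | P i) tsum (F i).
Proof.
move=> hF; elim: r => [|i r ih].
  by rewrite big_nil tsum0 // => k; rewrite big_nil.
rewrite big_cons -ih; case Pi: (P i); last first.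
  by apply: eq_tsum => k; rewrite big_cons Pi.
rewrite -tsumD //; last exact: fin_supp_sum.
by apply: eq_tsum => k; rewrite big_cons Pi.
Qed.

(** * Laurent series *)

Definition bounded (V : nmodType) (f : int -> V) : Prop :=
  exists v : int, forall k, k < v -> f k = 0.

Lemma fin_supp_conv (U V W : nmodType) (f : int -> U) (g : int -> V) (F : int -> W) (j : int) :
  bounded f -> bounded g ->
  (forall k, f k = 0 -> F k = 0) -> (forall k, g (j - k) = 0 -> F k = 0) -> fin_supp F.
Proof.
move=> [a ha] [b hb] hf hg; apply: (@fin_supp_itv _ F a (j - b)) => k lk.
  by rewrite hf ?ha.
by rewrite hg ?hb //; lia.
Qed.

(** Unlike [lser], where one series has many representations, this type has extensional Leibniz
    equality, hence carries a commutative ring structure. All algebra takes place here. *)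
Record lau (B : comNzRingType) := Lau { coef : int -> B; coef_bounded : bounded coef }.

Section Lau.
Variable B : comNzRingType.
Implicit Types f g h : lau B.

Lemma lau_eqP f g : (forall k, coef f k = coef g k) -> f = g.
Proof.
case: f g => [f hf] [g hg] /= /boolp.funext e; subst g.
by congr Lau; apply: boolp.Prop_irrelevance.
Qed.

HB.instance Definition _ := boolp.gen_eqMixin (lau B).
HB.instance Definition _ := boolp.gen_choiceMixin (lau B).

Lemma lau_zero_bounded : bounded (fun _ : int => 0 : B).
Proof. by exists 0. Qed.
Definition lau_zero := Lau lau_zero_bounded.

Lemma lau_opp_bounded f : bounded (fun k => - coef f k).
Proof. by case: (coef_bounded f) => v hv; exists v => k /hv ->; rewrite oppr0. Qed.
Definition lau_opp f := Lau (lau_opp_bounded f).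

Lemma lau_add_bounded f g : bounded (fun k => coef f k + coef g k).
Proof.
case: (coef_bounded f) (coef_bounded g) => v hv [w hw]; exists (Num.min v w) => k.
by rewrite lt_min => /andP[/hv-> /hw->]; rewrite addr0.
Qed.
Definition lau_add f g := Lau (lau_add_bounded f g).

Lemma lau_addA : associative lau_add.
Proof. by move=> f g h; apply: lau_eqP => k /=; rewrite addrA. Qed.
Lemma lau_addC : commutative lau_add.
Proof. by move=> f g; apply: lau_eqP => k /=; rewrite addrC. Qed.
Lemma lau_add0 : left_id lau_zero lau_add.
Proof. by move=> f; apply: lau_eqP => k /=; rewrite add0r. Qed.
Lemma lau_addN : left_inverse lau_zero lau_opp lau_add.
Proof. by move=> f; apply: lau_eqP => k /=; rewrite addNr. Qed.

HB.instance Definition _ :=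
  GRing.isZmodule.Build (lau B) lau_addA lau_addC lau_add0 lau_addN.

Lemma conv_fin_supp f g j : fin_supp (fun k => coef f k * coef g (j - k)).
Proof.
by apply: (fin_supp_conv (coef_bounded f) (coef_bounded g) (j := j)) => k ->;
  rewrite ?mul0r ?mulr0.
Qed.

Lemma lau_mul_bounded f g :
  bounded (fun j => tsum (fun k => coef f k * coef g (j - k))).
Proof.
case: (coef_bounded f) (coef_bounded g) => v hv [w hw]; exists (v + w) => k lk.
apply: tsum0 => l; case: (ltP l v) => [/hv->|lv]; first by rewrite mul0r.
by rewrite hw ?mulr0 //; lia.
Qed.
Definition lau_mul f g := Lau (lau_mul_bounded f g).

Definition monoF (b : B) (d k : int) : B := if k == d then b else 0.
Lemma mono_bounded (b : B) (d : int) : bounded (monoF b d).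
Proof. by exists d => k lk; rewrite /monoF lt_eqF. Qed.
Definition mono b d := Lau (mono_bounded b d).

Lemma lau_mulC : commutative lau_mul.
Proof.
move=> f g; apply: lau_eqP => j /=.
rewrite (tsum_reindex (h := fun k => j - k)).
- by apply: eq_tsum => k; rewrite mulrC; congr (coef _ _ * _); lia.
- by move=> a b; lia.
- exact: conv_fin_supp.
- by move=> k _; exists (j - k); lia.
Qed.

(** Both bracketings equal the double sum over [k] and [l] of [f_k g_(l-k) h_(j-l)], taken in the
    two possible orders. *)
Lemma lau_mulA : associative lau_mul.
Proof.
move=> f g h; apply: lau_eqP => j /=.
have [u hu] := coef_bounded f; have [v hv] := coef_bounded g; have [w hw] := coef_bounded h.
transitivity (tsum (fun k => tsum (fun l => coef f k * (coef g (l - k) * coef h (j - l))))).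
  apply: eq_tsum => k.
  rewrite -(raddf_tsum (f := fun x => coef f k * x)); last 3 first.
  - exact: mulr0.
  - by move=> x y; rewrite mulrDr.
  - apply: (@fin_supp_itv _ _ (k + v) (j - w)) => l ll; first by rewrite hv ?mul0r //; lia.
    by rewrite hw ?mulr0 //; lia.
  congr (_ * _); rewrite [RHS](tsum_reindex (h := fun l => k + l)).
  - by apply: eq_tsum => l; congr (coef _ _ * coef _ _); lia.
  - by move=> a b; lia.
  - apply: (@fin_supp_itv _ _ (k + v) (j - w)) => l ll; first by rewrite hv ?mul0r //; lia.
    by rewrite hw ?mulr0 //; lia.
  - by move=> l _; exists (l - k); lia.
(* The box comes from the lower bounds [u <= k], [v <= l - k] and [w <= j - l] on the degrees of a
   nonzero term. *)
rewrite (@exchange_tsum _ _ (zitv u (j - w - v)) (zitv (u + v) (j - w))); last first.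
  move=> k l nz.
  have uk : u <= k by rewrite leNgt; apply: contraNN nz => /hu->; rewrite mul0r.
  have vk : v <= l - k by rewrite leNgt; apply: contraNN nz => /hv->; rewrite mul0r mulr0.
  have wk : w <= j - l by rewrite leNgt; apply: contraNN nz => /hw->; rewrite !mulr0.
  by rewrite !mem_zitv; lia.
apply: eq_tsum => l.
rewrite (raddf_tsum (f := fun x => x * coef h (j - l))).
- by apply: eq_tsum => k; rewrite mulrA.
- exact: mul0r.
- by move=> x y; rewrite mulrDl.
- exact: conv_fin_supp.
Qed.

Lemma coef_mono_mul b d f j : coef (lau_mul (mono b d) f) j = b * coef f (j - d).
Proof.
by rewrite /= (@tsum1 _ _ d) /monoF ?eqxx // => k /negPf->; rewrite mul0r.
Qed.

Lemma lau_mul1 : left_id (mono 1 0) lau_mul.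
Proof. by move=> f; apply: lau_eqP => k; rewrite coef_mono_mul mul1r subr0. Qed.

Lemma lau_mulDl : left_distributive lau_mul +%R.
Proof.
move=> f g h; apply: lau_eqP => j /=.
rewrite -tsumD; [|exact: conv_fin_supp..].
by apply: eq_tsum => k; rewrite mulrDl.
Qed.

Lemma lau_one_neq0 : mono 1 0 != 0.
Proof.
apply/eqP => /(congr1 (fun f => coef f 0)) /=; rewrite /monoF eqxx => /eqP.
by rewrite oner_eq0.
Qed.

HB.instance Definition _ := GRing.Zmodule_isComNzRing.Build (lau B)
  lau_mulA lau_mulC lau_mul1 lau_mulDl lau_one_neq0.

Lemma lau_coefD f g k : coef (f + g) k = coef f k + coef g k. Proof. by []. Qed.
Lemma lau_coef0 k : coef (0 : lau B) k = 0. Proof. by []. Qed.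
Lemma lau_coefM f g j : coef (f * g) j = tsum (fun k => coef f k * coef g (j - k)).
Proof. by []. Qed.
Lemma lau_coef1 k : coef (1 : lau B) k = if k == 0 then 1 else 0. Proof. by []. Qed.
Lemma lau_coefMmono b d f j : coef (mono b d * f) j = b * coef f (j - d).
Proof. exact: coef_mono_mul. Qed.

Lemma lau_coef_sum (I : Type) (r : seq I) (P : pred I) (F : I -> lau B) k :
  coef (\sum_(i <- r | P i) F i) k = \sum_(i <- r | P i) coef (F i) k.
Proof. exact: (big_morph (fun f => coef f k)). Qed.

Lemma mono_mul (b c : B) d e : mono b d * mono c e = mono (b * c) (d + e).
Proof.
apply: lau_eqP => k; rewrite lau_coefMmono /= /monoF subr_eq [in RHS]addrC.
by case: ifP => _; rewrite ?mulr0.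
Qed.

Lemma mono_add (b c : B) d : mono b d + mono c d = mono (b + c) d.
Proof. by apply: lau_eqP => k /=; rewrite /monoF; case: ifP; rewrite ?addr0. Qed.

End Lau.

Section LauAlg.
Variables (A : comNzRingType) (B : comAlgType A).
Implicit Types (f g : lau B) (a b : A).

Lemma lau_scale_bounded a f : bounded (fun k => a *: coef f k).
Proof. by case: (coef_bounded f) => v hv; exists v => k /hv ->; rewrite scaler0. Qed.
Definition lau_scale a f : lau B := Lau (lau_scale_bounded a f).

Lemma lau_scaleA a b f : lau_scale a (lau_scale b f) = lau_scale (a * b) f.
Proof. by apply: lau_eqP => k /=; rewrite scalerA. Qed.
Lemma lau_scale1 : left_id 1 lau_scale.
Proof. by move=> f; apply: lau_eqP => k /=; rewrite scale1r. Qed.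
Lemma lau_scaleDr : right_distributive lau_scale +%R.
Proof. by move=> a f g; apply: lau_eqP => k /=; rewrite scalerDr. Qed.
Lemma lau_scaleDl f : {morph lau_scale^~ f : a b / a + b}.
Proof. by move=> a b; apply: lau_eqP => k /=; rewrite scalerDl. Qed.

HB.instance Definition _ := GRing.Zmodule_isLmodule.Build A (lau B)
  lau_scaleA lau_scale1 lau_scaleDr lau_scaleDl.

Lemma lau_scaleAl a f g : a *: (f * g) = (a *: f) * g.
Proof.
apply: lau_eqP => j; rewrite /= (raddf_tsum (f := fun x => a *: x)).
- by apply: eq_tsum => k; rewrite scalerAl.
- exact: scaler0.
- by move=> x y; rewrite scalerDr.
- exact: conv_fin_supp.
Qed.

HB.instance Definition _ := GRing.Lmodule_isLalgebra.Build A (lau B) lau_scaleAl.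

Lemma lau_scaleAr a f g : a *: (f * g) = f * (a *: g).
Proof. by rewrite mulrC lau_scaleAl mulrC. Qed.

HB.instance Definition _ := GRing.Lalgebra_isAlgebra.Build A (lau B) lau_scaleAr.

Lemma lau_coef_alg a k : coef (a%:A : lau B) k = if k == 0 then a%:A else 0.
Proof. by rewrite /= /monoF; case: ifP; rewrite ?scaler0. Qed.

End LauAlg.

(** * Points of the group scheme *)

(* Models the graph of a partially defined algebra morphism, such as the
   specialization [t |-> 0] on integral Laurent series. *)
Record alg_rel (A : comNzRingType) (R S : comAlgType A) (rel : R -> S -> Prop) : Prop := {
  alg_rel_in_alg : forall a : A, rel a%:A a%:A;
  alg_relD : forall x y x' y', rel x x' -> rel y y' -> rel (x + y) (x' + y');
  alg_relM : forall x y x' y', rel x x' -> rel y y' -> rel (x * y) (x' * y') }.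

Section AlgRel.
Variables (A : comNzRingType) (R S : comAlgType A) (rel : R -> S -> Prop).
Hypothesis hrel : alg_rel rel.

Lemma alg_rel0 : rel 0 0.
Proof. by have := alg_rel_in_alg hrel 0; rewrite !scale0r. Qed.

Lemma alg_rel1 : rel 1 1.
Proof. by have := alg_rel_in_alg hrel 1; rewrite !scale1r. Qed.

Lemma alg_rel_sum (I : Type) (r : seq I) (P : pred I) F G :
  (forall i, rel (F i) (G i)) ->
  rel (\sum_(i <- r | P i) F i) (\sum_(i <- r | P i) G i).
Proof.
move=> h; apply: (big_ind2 rel) => //; first exact: alg_rel0.
by move=> *; apply: alg_relD.
Qed.

Lemma alg_rel_mmap n (p : {mpoly A[n]}) (v : 'I_n -> R) (w : 'I_n -> S) :
  (forall i, rel (v i) (w i)) ->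
  rel (mmap (in_alg R) v p) (mmap (in_alg S) w p).
Proof.
move=> vw; rewrite /mmap; apply: alg_rel_sum => m; apply: (alg_relM hrel).
  exact: (alg_rel_in_alg hrel).
rewrite /mmap1; apply: (big_ind2 rel); first exact: alg_rel1.
  by move=> *; apply: (alg_relM hrel).
move=> i _; elim: (m i : nat) => [|k ih]; first by rewrite !expr0; apply: alg_rel1.
by rewrite !exprS; apply: (alg_relM hrel).
Qed.

Lemma alg_rel_mulmx m n p (X : 'M[R]_(m, n)) (Y : 'M[R]_(n, p))
    (X' : 'M[S]_(m, n)) (Y' : 'M[S]_(n, p)) :
  (forall i j, rel (X i j) (X' i j)) -> (forall i j, rel (Y i j) (Y' i j)) ->
  forall i j, rel ((X *m Y) i j) ((X' *m Y') i j).
Proof.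
move=> hX hY i j; rewrite !mxE; apply: alg_rel_sum => k.
exact: (alg_relM hrel).
Qed.

(** A defining equation evaluated at [M] is related to the same equation evaluated at [M']. The
    former is 0, and 0 is related to nothing but 0. This is how residues are shown to lie in the
    group. *)
Lemma ptsG_alg_rel N (I : {mpoly A[N * N]} -> Prop) (M : 'M[R]_N) (M' : 'M[S]_N) :
  (forall s, rel 0 s -> s = 0) -> (forall i j, rel (M i j) (M' i j)) ->
  ptsG I M -> ptsG I M'.
Proof.
move=> h0 hM hI p Ip; apply: h0; rewrite -(hI p Ip).
apply: alg_rel_mmap => k; case/mxvec_indexP: k => i j; rewrite !mxvecE.
exact: hM.
Qed.

End AlgRel.

Lemma ptsG_map (A : comNzRingType) (R S : comAlgType A) (phi : R -> S) N
    (I : {mpoly A[N * N]} -> Prop) (M : 'M[R]_N) :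
  (forall a, phi a%:A = a%:A) -> {morph phi : x y / x + y} -> {morph phi : x y / x * y} ->
  ptsG I M -> ptsG I (map_mx phi M).
Proof.
move=> p1 pD pM; apply: (@ptsG_alg_rel _ _ _ (fun x y => y = phi x)).
- by split=> [a|x y _ _ -> ->|x y _ _ -> ->].
- by move=> s ->; have := p1 0; rewrite !scale0r.
- by move=> i j; rewrite mxE.
Qed.

Lemma ptsG_det (A : comNzRingType) (R : comAlgType A) N (I : {mpoly A[N * N]} -> Prop)
    (M : 'M[R]_N) : I (\det (Xmx A N) - 1) -> ptsG I M -> \det M = 1.
Proof.
move=> Idet /(_ _ Idet) /eqP; rewrite rmorphB rmorph1 subr_eq0 => /eqP.
rewrite -det_map_mx => <-; congr (\det _); apply/matrixP => i j.
by rewrite !mxE /= mmapX mmap1U mxvecE.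
Qed.

(** * Comparison of [lser] with the ring [lau] *)

Section Emb.
Variable B : comNzRingType.
Implicit Types f g : lser B.

Lemma coefL_bounded f : bounded (coefL f).
Proof.
exists (lval f) => k lk; rewrite /coefL.
by case e: (k - lval f) => [i|//]; lia.
Qed.
Definition emb f : lau B := Lau (coefL_bounded f).

Lemma coefL_shift f (i : nat) : coefL f (lval f + i%:Z) = lcoef f i.
Proof. by rewrite /coefL addrC addKr. Qed.

Lemma coefL_lt f k : k < lval f -> coefL f k = 0.
Proof. by move=> lk; rewrite /coefL; case e: (k - lval f) => [i|//]; lia. Qed.

Lemma coefL_mkL v (c : int -> B) j : coefL (mkL v c) j = if v <= j then c j else 0.
Proof.
case: leP => h; last by rewrite coefL_lt.
have -> : j = v + (absz (j - v))%:Z by lia.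
by rewrite (coefL_shift (mkL v c)).
Qed.

Lemma emb_add f g : emb (addL f g) = emb f + emb g.
Proof.
apply: lau_eqP => j; rewrite /= coefL_mkL ge_min.
by case: (leP (lval f)) => // hf; case: (leP (lval g)) => // hg; rewrite /= !coefL_lt ?addr0.
Qed.

Lemma emb_mul f g : emb (mulL f g) = emb f * emb g.
Proof.
apply: lau_eqP => j; rewrite lau_coefM /=.
case: (ltP j (lval f + lval g)) => hj.
  rewrite coefL_lt // tsum0 // => k; case: (ltP k (lval f)) => hk.
    by rewrite coefL_lt // mul0r.
  by rewrite (@coefL_lt g) ?mulr0 //; lia.
pose d := absz (j - (lval f + lval g))%R.
have -> : j = lval f + lval g + d%:Z by lia.
rewrite (coefL_shift (mulL f g)) /=.
rewrite (@tsumE _ _ [seq (lval f + i%:Z)%R | i <- iota 0 d.+1]); last first.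
- move=> k; apply: contraNT => nk.
  case: (ltP k (lval f)) => hk; first by rewrite coefL_lt // mul0r.
  rewrite (@coefL_lt g) ?mulr0 //; case: ltP => // hg; case/negP: nk.
  by apply/mapP; exists (absz (k - lval f)); rewrite ?mem_iota; lia.
- by rewrite map_inj_uniq ?iota_uniq // => a b; lia.
rewrite big_map -[in RHS](subn0 d.+1) -/(index_iota _ _) big_mkord; apply: eq_bigr => i _.
rewrite coefL_shift; congr (_ * _).
rewrite -(coefL_shift g); congr (coefL g _).
by have := ltn_ord i; lia.
Qed.

Lemma emb_cst (b : B) : emb (cstL b) = mono b 0.
Proof.
apply: lau_eqP => j; rewrite /= /monoF.
case: j => [j|j]; last by rewrite coefL_lt.
by rewrite -[Posz j]add0r (coefL_shift (cstL b)) add0r.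
Qed.

Lemma emb_zero : emb (zeroL B) = 0.
Proof. by rewrite emb_cst; apply: lau_eqP => j; rewrite /= /monoF if_same. Qed.

Lemma emb_one : emb (oneL B) = 1.
Proof. exact: emb_cst. Qed.

Lemma emb_sum (I : Type) (r : seq I) (P : pred I) (F : I -> lser B) :
  emb (\big[@addL B/zeroL B]_(i <- r | P i) F i) = \sum_(i <- r | P i) emb (F i).
Proof. exact: (big_morph emb emb_add emb_zero). Qed.

Lemma emb_exp f k : emb (expL f k) = emb f ^+ k.
Proof. by elim: k => [|k ih]; rewrite ?emb_one // exprS -ih -emb_mul. Qed.

Lemma emb_mulM N (M M' : 'M[lser B]_N) :
  map_mx emb (mulML M M') = map_mx emb M *m map_mx emb M'.
Proof.
apply/matrixP => i j; rewrite !mxE emb_sum; apply: eq_bigr => k _.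
by rewrite emb_mul !mxE.
Qed.

End Emb.

Section EmbG.
Variables (A : comNzRingType) (N : nat).
Implicit Type g : 'M[lser A]_N.

(** The regular algebra [A^o] is used so that the Laurent series form an [A]-algebra, as [ptsG]
    requires. *)
Definition embM g : 'M[lau A^o]_N := map_mx (@emb A^o) g.

Lemma emb_eval n (p : {mpoly A[n]}) (v : 'I_n -> lser A) :
  @emb A^o (evalL p v) = mmap (in_alg (lau A^o)) (fun i => @emb A^o (v i)) p.
Proof.
rewrite /evalL emb_sum /mmap; apply: eq_bigr => m _.
rewrite (@emb_mul A^o) (@emb_cst A^o); congr (_ * _).
  by apply: lau_eqP => k; rewrite lau_coef_alg /= /monoF [in RHS]/GRing.scale /= mulr1.
rewrite (big_morph (@emb A^o) (@emb_mul A^o) (@emb_one A^o)) /mmap1.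
by apply: eq_bigr => i _; rewrite (@emb_exp A^o).
Qed.

Lemma emb_ptsG (I : {mpoly A[N * N]} -> Prop) g : ptsGL I g -> ptsG I (embM g).
Proof.
move=> hg p Ip; have /(_ _ Ip) null := hg.
apply: lau_eqP => k; rewrite lau_coef0 -(null k).
change (coefL (evalL p (fun k => mxvec g 0 k)) k)
  with (coef (@emb A^o (evalL p (fun k => mxvec g 0 k))) k).
rewrite emb_eval; congr (coef (mmap _ _ _) _); apply: boolp.funext => i.
by case/mxvec_indexP: i => a b; rewrite !mxvecE mxE.
Qed.

Lemma emb_adj g : embM (adjL g) = \adj (embM g).
Proof.
apply/matrixP => i j; rewrite mxE mxE emb_eval.
have -> : mmap (in_alg (lau A^o)) (fun k => @emb A^o (mxvec g 0 k)) (\adj (Xmx A N) i j)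
   = (map_mx (mmap (in_alg (lau A^o)) (fun k => @emb A^o (mxvec g 0 k))) (\adj (Xmx A N))) i j.
  by rewrite [RHS]mxE.
suff -> : embM g = map_mx (mmap (in_alg (lau A^o)) (fun k => @emb A^o (mxvec g 0 k))) (Xmx A N).
  by rewrite map_mx_adj.
apply/matrixP => a b; by rewrite !mxE /= mmapX mmap1U mxvecE.
Qed.

End EmbG.

(** * Binomial coefficients and Hasse derivatives *)

Lemma binz0 k : binz k 0 = 1.
Proof. by case: k => p; rewrite /= ?addn0 bin0. Qed.

Lemma binz0n i : binz 0 i = (i == 0%N)%:R.
Proof. by case: i. Qed.

Lemma binzS k i : binz (k + 1) i.+1 = binz k i.+1 + binz k i.
Proof.
case: k => [p|[|p]].
- by rewrite -PoszD addn1 /= binS.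
- have -> : Negz 0 + 1 = 0 :> int by [].
  by rewrite binz0n /= !add0n !binn exprS; ring.
- have -> : Negz p.+1 + 1 = Negz p by lia.
  rewrite /= (addSn p i.+1) binS addnS addSn exprS PoszD; ring.
Qed.

Lemma binz_fall k i : binz k i.+1 * (i.+1)%:Z = binz k i * (k - i%:Z).
Proof.
case: k => p /=.
  rewrite -PoszM mulnC mul_bin_left.
  case: (leqP i p) => h; first by rewrite PoszM subzn // mulrC.
  by rewrite bin_small // muln0 mul0r.
have e : (i.+1 * 'C(p + i.+1, i.+1) = (p + i).+1 * 'C(p + i, i))%N.
  by rewrite addnS mul_bin_diag.
rewrite -mulrA -PoszM mulnC e NegzE exprS PoszM; ring.
Qed.

(** Extension by zero to negative [i], so that the binomials are the coefficients of a Laurent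
    series. *)
Definition binZ (k i : int) : int := if i is Posz p then binz k p else 0.

Lemma binZ_lt0 k i : i < 0 -> binZ k i = 0.
Proof. by case: i. Qed.

Lemma binZ_bounded k : bounded (binZ k).
Proof. by exists 0 => i /binZ_lt0. Qed.

(** The binomial series [(1 + T)^k], with [k] of either sign and [T = mono 1 1]. *)
Definition bin_ser k : lau int := Lau (binZ_bounded k).

Lemma bin_serS k : (1 + mono 1 1) * bin_ser k = bin_ser (k + 1).
Proof.
apply: lau_eqP => i; rewrite mulrDl mul1r lau_coefD lau_coefMmono mul1r /=.
case: i => [[|i]|i] //.
- by rewrite /= !binz0 addr0.
- have -> : Posz i.+1 - 1 = i by lia.
  by rewrite /= binzS.
Qed.

Lemma bin_ser0 : bin_ser 0 = 1.
Proof. by apply: lau_eqP => i; rewrite lau_coef1; case: i => [[|i]|i]. Qed.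

(** Induction on [k] in both directions. The descending step cancels the factor [1 + T], whose
    inverse is [bin_ser (-1)]. *)
Lemma bin_ser_mul k l : bin_ser k * bin_ser l = bin_ser (k + l).
Proof.
elim/int_ind: k => [|n ih|n ih]; first by rewrite bin_ser0 mul1r add0r.
  have -> : n.+1 = n%:Z + 1 :> int by lia.
  by rewrite -bin_serS -mulrA ih bin_serS; congr bin_ser; lia.
have inj f g : (1 + mono 1 1) * f = (1 + mono 1 1) * g -> f = g :> lau int.
  move=> /(congr1 (fun x => bin_ser (-1) * x)); rewrite !mulrA ![bin_ser (-1) * _]mulrC.
  by rewrite bin_serS addNr bin_ser0 !mul1r.
apply: inj; rewrite mulrA !bin_serS.
have -> : - n.+1%:Z + 1 = - n%:Z by lia.
by rewrite ih; congr bin_ser; lia.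
Qed.

Lemma binZ_vandermonde k l i : tsum (fun c => binZ k c * binZ l (i - c)) = binZ (k + l) i.
Proof. by have := congr1 (fun f => coef f i) (bin_ser_mul k l). Qed.

(** Induction on [a]: after multiplication by [a + 1], [binz_fall] applies on both sides, and the
    factor is cancelled in the integers. *)
Lemma binz_trinomial k b a :
  binz k b * binz (k - b%:Z) a = 'C(a + b, b)%:Z * binz k (a + b).
Proof.
elim: a => [|a ih]; first by rewrite binz0 binn mulr1 mul1r.
have e : ('C(a.+1 + b, b) * a.+1 = 'C(a + b, b) * (a + b).+1)%N.
  by rewrite addSn [RHS]mulnC (mul_bin_down (a + b).+1 b) -addSn addnK mulnC.
apply: (@mulIf _ (a.+1)%:Z) => //.
rewrite -mulrA binz_fall mulrA ih [RHS]mulrAC -PoszM e PoszM -[in RHS]mulrA.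
rewrite [X in _ = _ * X]mulrC addSn binz_fall PoszD; ring.
Qed.

Section Hasse.
Variable B : comNzRingType.
Implicit Types f g : lau B.

Lemma hasse_bounded (i : nat) f : bounded (fun k => coef f k *~ binz k i).
Proof. by case: (coef_bounded f) => v hv; exists v => k /hv ->; rewrite mul0rz. Qed.
Definition hasse i f : lau B := Lau (hasse_bounded i f).

Lemma taylor_row_bounded (b i : int) f :
  bounded (fun k => coef f k *~ binZ (k - b) (i - b)).
Proof. by case: (coef_bounded f) => v hv; exists v => k /hv ->; rewrite mul0rz. Qed.

Lemma taylor_bounded (b : int) f :
  bounded (fun i => Lau (taylor_row_bounded b i f)).
Proof.
exists b => i ib; apply: lau_eqP => k /=; rewrite binZ_lt0 ?mulr0z //; lia.
Qed.

(* [(ut)^b] times the image of [f / t^b] under [t |-> t(1 + u)]; the outer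
   variable is [u]. *)
Definition taylor b f : lau (lau B) := Lau (taylor_bounded b f).

Lemma coef_taylor b f i k :
  coef (coef (taylor b f) i) k = coef f k *~ binZ (k - b) (i - b).
Proof. by []. Qed.

Lemma taylorD b f g : taylor b (f + g) = taylor b f + taylor b g.
Proof.
by apply: lau_eqP => i; apply: lau_eqP => k; rewrite /= mulrzDl.
Qed.

(** [taylor 0] is the substitution [t |-> t(1 + u)], and [taylor b] is semilinear over it. On
    coefficients this is the Vandermonde identity for the splitting [k - b = l + (k - l - b)]. *)
Lemma taylorM b f g : taylor b (f * g) = taylor 0 f * taylor b g.
Proof.
apply: lau_eqP => i; apply: lau_eqP => k; rewrite coef_taylor [in RHS]lau_coefM.
rewrite (raddf_tsum (f := fun h => coef h k)) //; last exact: conv_fin_supp.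
have [v hv] := coef_bounded f; have [w hw] := coef_bounded g.
rewrite [RHS](@exchange_tsum _ _ (zitv 0 (i - b)) (zitv v (k - w))); last first.
  move=> c l; rewrite !coef_taylor !mem_zitv !subr0 => nz.
  have vl : v <= l by rewrite leNgt; apply: contraNN nz => /hv->; rewrite mul0rz mul0r.
  have wl : w <= k - l by rewrite leNgt; apply: contraNN nz => /hw->; rewrite mul0rz mulr0.
  have c0 : 0 <= c by rewrite leNgt; apply: contraNN nz => /binZ_lt0->; rewrite mulr0z mul0r.
  have ic : 0 <= i - c - b.
    by rewrite leNgt; apply: contraNN nz => /binZ_lt0->; rewrite mulr0z mulr0.
  lia.
rewrite lau_coefM (raddf_tsum (f := fun x => x *~ binZ (k - b) (i - b))); last 3 first.
- exact: mul0rz.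
- by move=> x y; rewrite mulrzDl.
- exact: conv_fin_supp.
apply: eq_tsum => l.
have -> : k - b = l + (k - l - b) by lia.
rewrite -binZ_vandermonde (raddf_tsum (f := fun n : int => _ *~ n)).
- apply: eq_tsum => c; rewrite !coef_taylor !subr0 mulrzAl mulrzAr -mulrzA.
  by rewrite [i - c - b]addrAC [binZ l c * _]mulrC.
- exact: mulr0z.
- by move=> x y; rewrite mulrzDr.
- apply: (@fin_supp_itv _ _ 0 (i - b)) => c hc; first by rewrite binZ_lt0 ?mul0r.
  by rewrite mulrC binZ_lt0 ?mul0r //; lia.
Qed.

Lemma coef_taylor0 f (i : nat) : coef (taylor 0 f) i = hasse i f.
Proof. by apply: lau_eqP => k; rewrite coef_taylor !subr0. Qed.

Lemma coef_taylor_lt b f i : i < b -> coef (taylor b f) i = 0.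
Proof.
by move=> ib; apply: lau_eqP => k; rewrite coef_taylor binZ_lt0 ?mulr0z //; lia.
Qed.

(** Trinomial revision: [binom(k, b) binom(k - b, i - b) = binom(i, b) binom(k, i)]. *)
Lemma taylor_hasse (b i : nat) f : coef (taylor b (hasse b f)) i = hasse i f *+ 'C(i, b).
Proof.
have [ib|bi] := ltnP i b; first by rewrite coef_taylor_lt ?bin_small.
have cMn (h : lau B) n k : coef (h *+ n) k = coef h k *+ n.
  by elim: n => [|n ihn]; rewrite ?mulr0n // !mulrS lau_coefD ihn.
apply: lau_eqP => k; rewrite coef_taylor cMn /= -mulrzA.
have -> : i%:Z - b%:Z = (i - b)%N by lia.
rewrite /= binz_trinomial subnK // mulrC mulrzA -pmulrn; congr (_ *+ _).
Qed.

End Hasse.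

(** * The matrices g^-1 D_i(g) *)

Lemma bounded_fin (V : nmodType) (I : finType) (F : I -> int -> V) :
  (forall i, bounded (F i)) -> exists c : int, forall i k, k < c -> F i k = 0.
Proof.
move=> hF; pose b i := projT1 (boolp.cid (hF i)).
(* This integer is at most every [b i], and needs no case distinction for an empty index type. *)
exists (- \sum_i `|b i|) => i k kc; apply: (projT2 (boolp.cid (hF i))); rewrite -/(b i).
have : `|b i| <= \sum_i `|b i| by rewrite (bigD1 i) //= lerDl sumr_ge0.
lia.
Qed.

Section Wronskian.
Variables (B : comNzRingType) (N : nat) (G H : 'M[lau B]_N).

Definition wronsk (i : nat) : 'M[lau B]_N := H *m map_mx (hasse i) G.

(** The generating series of the matrices [wronsk i] in the outer variable [u]. With [H] the inverse
    of [G], it is [G^{-1}] times the image of [G] under [t |-> t(1 + u)]. *)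
Definition wronsk_ser : 'M[lau (lau B)]_N :=
  map_mx (fun f => mono f 0) H *m map_mx (taylor 0) G.

Lemma coef_cst_mulmx (X : 'M[lau (lau B)]_N) x y i :
  coef ((map_mx (fun f => mono f 0) H *m X) x y) i = \sum_z H x z * coef (X z y) i.
Proof.
rewrite mxE lau_coef_sum; apply: eq_bigr => z _.
by rewrite mxE lau_coefMmono subr0.
Qed.

Lemma coef_wronsk_ser x y (i : nat) : coef (wronsk_ser x y) i = wronsk i x y.
Proof.
rewrite coef_cst_mulmx mxE; apply: eq_bigr => z _.
by rewrite !mxE coef_taylor0.
Qed.

Lemma coef_wronsk_ser_lt x y (i : int) : i < 0 -> coef (wronsk_ser x y) i = 0.
Proof.
move=> i0; rewrite coef_cst_mulmx big1 // => z _.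
by rewrite mxE coef_taylor_lt ?mulr0.
Qed.

(** The bound is uniform in [i] because Hasse derivatives do not enlarge the support. This
    uniformity is what later allows a positive index to be lowered. *)
Lemma wronsk_bounded : exists c : int, forall i k x y, k < c -> coef (wronsk i x y) k = 0.
Proof.
have bdM (X : 'M[lau B]_N) : exists c : int, forall x y k, k < c -> coef (X x y) k = 0.
  have [c hc] := bounded_fin (fun z : 'I_N * 'I_N => coef_bounded (X z.1 z.2)).
  by exists c => x y k; apply: (hc (x, y)).
have [c hc] := bdM H; have [d hd] := bdM G.
exists (c + d) => i k x y kcd; rewrite mxE lau_coef_sum big1 // => z _.
rewrite lau_coefM tsum0 // => l; case: (ltP l c) => lc; first by rewrite hc ?mul0r.
by rewrite !mxE /= hd ?mul0rz ?mulr0 //; lia.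
Qed.

(** The composition law: apply [taylor b] to [D_b(G) = G W_b], multiply by [H] on the left, and
    evaluate the side of [D_b(G)] by [taylor_hasse]. *)
Lemma wronsk_ser_taylor x y (b i : nat) : G *m H = 1%:M -> H *m G = 1%:M ->
  coef ((wronsk_ser *m map_mx (taylor b) (wronsk b)) x y) i = wronsk i x y *+ 'C(i, b).
Proof.
move=> GH HG.
have taylor_mulmx (X Y : 'M[lau B]_N) :
    map_mx (taylor b) (X *m Y) = map_mx (taylor 0) X *m map_mx (taylor b) Y.
  have t0 : taylor b 0 = 0 :> lau (lau B).
    by apply: lau_eqP => j; apply: lau_eqP => k; rewrite coef_taylor lau_coef0 mul0rz.
  apply/matrixP => x' y'; rewrite !mxE (big_morph (taylor b) (@taylorD _ b) t0).
  by apply: eq_bigr => z _; rewrite taylorM !mxE.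
have hb : map_mx (hasse b) G = G *m wronsk b by rewrite mulmxA GH mul1mx.
rewrite -mulmxA -taylor_mulmx -hb coef_cst_mulmx mxE -sumrMnl; apply: eq_bigr => z _.
by rewrite !mxE taylor_hasse mulrnAr.
Qed.

End Wronskian.

(** * Weights of monomials and parts of weight zero *)

Section Weight.
Variables (m n : nat).
Hypothesis n_gt0 : (0 < n)%N.

(* [n] times the weight [k + (m/n) i] of the monomial [u^i t^k]. *)
Definition wt (i k : int) : int := n%:Z * k + m%:Z * i.

Section WCoef.
Variable B : comNzRingType.
Implicit Types (f g : lau B).

(* Coefficient of [t^k] with [wt i k = 0], if such a [k] exists. *)
Definition wcoef f (i : nat) : B :=
  if (n %| m * i)%N then coef f (- ((m * i) %/ n)%N%:Z) else 0.

Lemma wcoefE f (i : nat) k : wt i k = 0 -> wcoef f i = coef f k.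
Proof.
rewrite /wt /wcoef => e; have d : (m * i = n * absz k)%N by nia.
by rewrite d dvdn_mulr // mulKn //; congr coef; nia.
Qed.

Lemma wcoef_ndiv f (i : nat) : (forall k, wt i k != 0) -> wcoef f i = 0.
Proof.
move=> h; rewrite /wcoef; case: ifP => // /dvdnP[q e].
by case/negP: (h (- q%:Z)); rewrite /wt; nia.
Qed.

Lemma wtP (i : nat) : (exists k, wt i k = 0) \/ (forall k, wt i k != 0).
Proof.
case: (boolp.pselect (exists k, wt i k = 0)) => h; first by left.
by right => k; apply/eqP => e; apply: h; exists k.
Qed.

Lemma wcoefD i : {morph wcoef^~ i : f g / f + g}.
Proof. by move=> f g; rewrite /wcoef; case: ifP; rewrite ?addr0. Qed.

Lemma wcoef0 i : wcoef 0 i = 0.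
Proof. by rewrite /wcoef if_same. Qed.

(** Weights add up. As no factor has a term of negative weight, a term of weight 0 in the product
    comes from two terms of weight 0. If one factor has no degree of weight 0, both sides vanish. *)
Lemma wcoefM f g (a b : nat) :
  (forall k, coef f k != 0 -> 0 <= wt a k) -> (forall k, coef g k != 0 -> 0 <= wt b k) ->
  wcoef (f * g) (a + b) = wcoef f a * wcoef g b.
Proof.
move=> hf hg.
have z k l : wt (a + b)%N k = 0 -> wt a l != 0 -> coef f l * coef g (k - l) = 0.
  move=> ek nl; apply/eqP/contraT => nz.
  have /hf h1 : coef f l != 0 by apply: contraNN nz => /eqP->; rewrite mul0r.
  have /hg h2 : coef g (k - l) != 0 by apply: contraNN nz => /eqP->; rewrite mulr0.
  by rewrite /wt in ek nl h1 h2; nia.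
case: (wtP (a + b)) => [[k ek]|hab].
  rewrite (wcoefE _ ek) lau_coefM; case: (wtP a) => [[l el]|ha].
    rewrite (@tsum1 _ _ l) => [|l' nl]; last first.
      by apply: z => //; apply: contraNN nl => /eqP; rewrite /wt in el *; nia.
    rewrite (wcoefE _ el) (@wcoefE g b (k - l)) //.
    by rewrite /wt in ek el *; nia.
  by rewrite (wcoef_ndiv _ ha) mul0r tsum0 // => l; apply: z.
rewrite (wcoef_ndiv _ hab).
case: (wtP a) => [[l el]|ha]; last by rewrite (wcoef_ndiv _ ha) mul0r.
rewrite (wcoef_ndiv g) ?mulr0 // => k; apply: contraNN (hab (k + l)) => /eqP e.
by rewrite /wt in e el *; nia.
Qed.

(** [X] is a power series in [u] without monomials of negative weight, and [q] is its part of weight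
    0. It is a relation because this part exists only for some [X] and must be polynomial in [u]. *)
Definition wrel (X : lau (lau B)) (q : {poly B}) : Prop :=
  [/\ forall i, i < 0 -> coef X i = 0,
      forall (i : nat) k, coef (coef X i) k != 0 -> 0 <= wt i k
    & forall i : nat, q`_i = wcoef (coef X i) i].

Lemma wrelD X Y p q : wrel X p -> wrel Y q -> wrel (X + Y) (p + q).
Proof.
move=> [X1 X2 X3] [Y1 Y2 Y3]; split=> [i i0|i k|i].
- by rewrite lau_coefD X1 // Y1 // addr0.
- rewrite lau_coefD; case: (eqVneq (coef (coef X i) k) 0) => [e|/X2 //].
  by rewrite lau_coefD e add0r => /Y2.
- by rewrite lau_coefD wcoefD coefD X3 Y3.
Qed.

Lemma wrelM X Y p q : wrel X p -> wrel Y q -> wrel (X * Y) (p * q).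
Proof.
move=> [X1 X2 X3] [Y1 Y2 Y3].
have cXY (i : nat) : coef (X * Y) i = \sum_(c < i.+1) coef X c * coef Y (i - c)%N.
  rewrite lau_coefM (@tsumE _ _ [seq Posz c | c <- iota 0 i.+1]).
  - rewrite big_map -[in LHS](subn0 i.+1) -/(index_iota _ _) big_mkord.
    apply: eq_bigr => c _; congr (_ * coef _ _); have := ltn_ord c; lia.
  - by rewrite map_inj_uniq ?iota_uniq // => a b [].
  - move=> c; apply: contraNT => nc; case: (ltP c 0) => c0; first by rewrite X1 ?mul0r.
    rewrite Y1 ?mulr0 //; case: ltP => // ci; case/negP: nc; apply/mapP.
    by exists (absz c); rewrite ?mem_iota; lia.
split=> [i i0|i k|i].
- rewrite lau_coefM tsum0 // => c; case: (ltP c 0) => c0; first by rewrite X1 ?mul0r.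
  by rewrite Y1 ?mulr0 //; lia.
- rewrite cXY lau_coef_sum leNgt; apply: contraNN => wi; apply/eqP/big1 => c _.
  rewrite lau_coefM tsum0 // => l; apply/eqP/contraT => nz.
  have /X2 h1 : coef (coef X c) l != 0 by apply: contraNN nz => /eqP->; rewrite mul0r.
  have /Y2 h2 : coef (coef Y (i - c)%N) (k - l) != 0
    by apply: contraNN nz => /eqP->; rewrite mulr0.
  have := ltn_ord c; rewrite /wt in wi h1 h2; nia.
- rewrite cXY coefM (big_morph (wcoef^~ i) (wcoefD i) (wcoef0 i)); apply: eq_bigr => c _.
  have e : i = (c + (i - c))%N by have := ltn_ord c; lia.
  by rewrite X3 Y3 -wcoefM -?e //; [apply: X2 | apply: Y2].
Qed.

End WCoef.

Lemma wrel_alg (A : comNzRingType) :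
  @alg_rel A (lau (lau A^o)) {poly A} (@wrel A^o).
Proof.
split; [|exact: wrelD|exact: wrelM].
move=> a; split=> [i i0|i k|i].
- by rewrite lau_coef_alg lt_eqF.
- rewrite lau_coef_alg; case: i => [|i]; last by rewrite /= eqxx.
  by rewrite eqxx lau_coef_alg; case: (eqVneq k 0) => [-> _|_]; rewrite ?eqxx // /wt; lia.
- rewrite lau_coef_alg alg_polyC coefC; case: i => [|i] /=; last by rewrite wcoef0.
  rewrite (@wcoefE _ _ _ 0); last by rewrite /wt; lia.
  by rewrite lau_coef_alg eqxx [in RHS]/GRing.scale /= mulr1.
Qed.

End Weight.

(** Passing from [u^b t^k] to [u^i t^k] with [i > b] raises the weight by [m(i - b) > 0]. So only
    the leading term [i = b] can have weight 0. *)
Lemma wrel_taylor (m n : nat) (m_gt0 : (0 < m)%N) (n_gt0 : (0 < n)%N)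
    (B : comNzRingType) (f : lau B) (b : nat) :
  (forall k, coef f k != 0 -> 0 <= wt m n b k) ->
  wrel m n (taylor b f) ((wcoef m n f b)%:P * 'X^b).
Proof.
move=> hf; split=> [i i0|i k|i].
- by rewrite coef_taylor_lt //; lia.
- rewrite coef_taylor => nz.
  have /hf : coef f k != 0 by apply: contraNN nz => /eqP->; rewrite mul0rz.
  have : 0 <= i%:Z - b%:Z.
    by rewrite leNgt; apply: contraNN nz => /binZ_lt0->; rewrite mulr0z.
  by rewrite /wt; nia.
- rewrite coefCM coefXn.
  have [ib|bi] := ltnP i b.
    by rewrite ltn_eqF // mulr0 coef_taylor_lt // wcoef0.
  have [->|neq] := eqVneq i b.
    rewrite mulr1; congr (wcoef _ _ _ _); apply: lau_eqP => k.
    by rewrite coef_taylor subrr /= binz0.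
  rewrite mulr0; case: (wtP m n i) => [[k ek]|h]; last by rewrite wcoef_ndiv.
  rewrite (wcoefE n_gt0 _ ek) coef_taylor; have [->|/hf] := eqVneq (coef f k) 0.
    by rewrite mul0rz.
  by rewrite /wt in ek *; nia.
Qed.

(** * Coefficients of [ramL] and [sigmaL] *)

Section Sigma.
Variables (A : comNzRingType) (m n : nat).
Hypotheses (m_gt0 : (0 < m)%N) (n_gt0 : (0 < n)%N).
Implicit Type f : lser A.

Lemma coefL_ramL f k : coefL (ramL n f) (n%:Z * k) = (coefL f k)%:P.
Proof.
rewrite coefL_mkL dvdz_mulr // mulKz; last by lia.
by case: ifP => // h; rewrite coefL_lt //; nia.
Qed.

Lemma coefL_ramL_ndvd f j : (forall k, j != n%:Z * k) -> coefL (ramL n f) j = 0.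
Proof.
move=> h; rewrite coefL_mkL; case: ifP => // _; case: ifP => // /dvdzP[k e].
by case/negP: (h k); rewrite e mulrC.
Qed.

(** The scalar is a function of the exponent of [u], since the binomial factor in [sigmaL] depends
    on that exponent. *)
Lemma coef_sigmaL_term (c : int -> A) (e : int) (i : nat) :
  (if (0 <= e) && (e \in dvdz m%:Z)
   then (c `|(e %/ m%:Z)%Z|%N)%:P * 'X^(`|(e %/ m%:Z)%Z|%N) else 0)`_i
  = if e == m%:Z * i%:Z then c i else 0.
Proof.
case: ifP => [/andP[e0 /dvdzP[q eq]]|h].
  have mq : (e %/ m%:Z)%Z = q by rewrite eq mulzK //; lia.
  rewrite mq coefCM coefXn.
  case: eqVneq => [->|ne]; first by rewrite mulr1 ifT //; apply/eqP; nia.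
  by rewrite mulr0 ifF //; apply/negbTE/eqP => e'; case/eqP: ne; nia.
rewrite coef0 ifF //; apply: contraFF h => /eqP->.
by rewrite dvdz_mulr //; lia.
Qed.

(** Since [n > 0], at most one summand contributes to [u^i]. The two hypotheses treat at once the
    exponents [j] of the form [wt m n i k] and the others, where [c = 0]. *)
Lemma coef_sigmaL f j (i : nat) (c : A) :
  (forall k', j - lval f * n%:Z - (n * k')%N%:Z = m%:Z * i%:Z ->
     coefL f (lval f + k'%:Z) *~ binz (lval f + k'%:Z) i = c) ->
  (c != 0 -> exists2 k, lval f <= k & j = wt m n i k) ->
  (coefL (sigmaL m n f) j)`_i = c.
Proof.
move=> h1 h2; rewrite coefL_mkL; set d := j - lval f * n%:Z.
have [c0|/h2[k vk ek]] := eqVneq c 0.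
  rewrite c0 in h1 *; case: ifP => _; last by rewrite coef0.
  rewrite coef_sum big1 // => k' _ /=.
  rewrite (@coef_sigmaL_term (fun q => coefL f (lval f + k'%:Z) *~
     binz (lval f + k'%:Z) (absz q))) /=.
  by case: eqP => // /h1.
rewrite ifT; last by rewrite /wt in ek; nia.
(* The index of the contributing summand. It lies in the summation range because [d = n k' + m i]
   gives [k' <= d]. *)
pose k' := absz (k - lval f)%R.
have lk' : (k' < `|d|.+1)%N by rewrite /wt in ek; rewrite /k' /d; nia.
rewrite coef_sum (bigD1 (Ordinal lk')) //= big1 => [|l nl].
  rewrite addr0 (@coef_sigmaL_term (fun q => coefL f (lval f + k'%:Z) *~
     binz (lval f + k'%:Z) (absz q))) /=.
  have e : d - (n * k')%N%:Z = m%:Z * i%:Z by rewrite /wt in ek; rewrite /k' /d; nia.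
  by rewrite e eqxx h1.
rewrite (@coef_sigmaL_term (fun q => coefL f (lval f + l%:Z) *~
     binz (lval f + l%:Z) (absz q))) /=.
rewrite ifF //; apply/negbTE; apply: contraNN nl => /eqP e; apply/eqP/val_inj => /=.
have : n%:Z * (k - lval f - l%:Z) == 0.
  by rewrite /wt in ek; move: e; rewrite /d PoszM; move: (l : nat) => l0; nia.
by rewrite mulf_eq0 /k'; lia.
Qed.

Lemma coef_sigmaL_wt f (i : nat) k :
  (coefL (sigmaL m n f) (wt m n i k))`_i = coefL f k *~ binz k i.
Proof.
apply: coef_sigmaL => [k' e|nz].
  by have -> : k = lval f + k'%:Z by rewrite /wt in e; nia.
exists k => //; rewrite leNgt; apply: contraNN nz => /coefL_lt->.
by rewrite mul0rz.
Qed.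

Lemma coef_sigmaL_nwt f (i : nat) j : (forall k, j != wt m n i k) ->
  (coefL (sigmaL m n f) j)`_i = 0.
Proof.
move=> h; apply: coef_sigmaL => [k' e|]; last by rewrite eqxx.
by case/negP: (h (lval f + k'%:Z)); rewrite /wt; nia.
Qed.

Lemma coef_ramL_sigmaL (h f : lser A) j (i : nat) :
  (coef (emb (ramL n h) * emb (sigmaL m n f)) j)`_i =
  tsum (fun l => (coefL (ramL n h) l)`_0 * (coefL (sigmaL m n f) (j - l))`_i).
Proof.
rewrite lau_coefM (raddf_tsum (f := fun p : {poly A} => p`_i)).
- apply: eq_tsum => l /=.
  case: (boolp.pselect (exists k, l = n%:Z * k)) => [[k ->]|nk].
    by rewrite coefL_ramL coefC eqxx coefCM.
  rewrite coefL_ramL_ndvd ?mul0r ?coef0 ?mul0r // => k.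
  by apply/eqP => e; apply: nk; exists k.
- exact: coef0.
- by move=> x y; rewrite coefD.
- exact: conv_fin_supp.
Qed.

(** The ramified factor is constant in [u] and lives in exponents divisible by [n]. Reindexing by
    [l |-> n l] turns the convolution into that of [h] with [D_i(f)]. *)
Lemma coef_ramL_sigmaL_wt (h f : lser A) (i : nat) k :
  (coef (emb (ramL n h) * emb (sigmaL m n f)) (wt m n i k))`_i =
  coef (emb h * hasse i (emb f)) k.
Proof.
rewrite coef_ramL_sigmaL lau_coefM (tsum_reindex (h := fun l => n%:Z * l)).
- apply: eq_tsum => l; rewrite coefL_ramL coefC eqxx.
  have -> : wt m n i k - n%:Z * l = wt m n i (k - l) by rewrite /wt; ring.
  by rewrite coef_sigmaL_wt.
- by move=> a b; nia.
- apply: (fin_supp_conv (coefL_bounded (ramL n h)) (coefL_bounded (sigmaL m n f))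
    (j := wt m n i k)) => l ->; by rewrite coef0 ?mul0r ?mulr0.
- move=> l nz; case: (boolp.pselect (exists k, l = n%:Z * k)) => // nk.
  case/negP: nz; rewrite coefL_ramL_ndvd ?coef0 ?mul0r // => l'.
  by apply/eqP => e; apply: nk; exists l'.
Qed.

Lemma coef_ramL_sigmaL_nwt (h f : lser A) (i : nat) j : (forall k, j != wt m n i k) ->
  (coef (emb (ramL n h) * emb (sigmaL m n f)) j)`_i = 0.
Proof.
move=> hj; rewrite coef_ramL_sigmaL tsum0 // => l.
case: (boolp.pselect (exists k, l = n%:Z * k)) => [[k ->]|nk].
  rewrite coef_sigmaL_nwt ?mulr0 // => k'; apply: contraNN (hj (k + k')) => /eqP.
  by rewrite /wt => e; apply/eqP; lia.
rewrite coefL_ramL_ndvd ?coef0 ?mul0r // => l'.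
by apply/eqP => e; apply: nk; exists l'.
Qed.

End Sigma.

(** * Good exponents in terms of the matrices [W_i] *)

Section Hmat.
Variables (A : comNzRingType) (N : nat) (g : 'M[lser A]_N).

Definition wronskG (i : nat) : 'M[lau A^o]_N := wronsk (embM g) (\adj (embM g)) i.

Lemma hmatE r x y : emb (hmat g r x y) =
  \sum_z emb (ramL (denN r) (adjL g x z)) * emb (sigmaL (numN r) (denN r) (g z y)).
Proof.
have := congr1 (fun M : 'M_N => M x y) (emb_mulM
  (map_mx (ramL (denN r)) (adjL g)) (map_mx (sigmaL (numN r) (denN r)) g)).
by rewrite !mxE => ->; apply: eq_bigr => z _; rewrite !mxE.
Qed.

Lemma numN_gt0 (r : rat) : 0 < r -> (0 < numN r)%N.
Proof. by rewrite -numq_gt0 /numN; lia. Qed.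

Lemma denN_gt0 (r : rat) : (0 < denN r)%N.
Proof. by have := denq_gt0 r; rewrite /denN; lia. Qed.

(** With [s = t^{1/n}] and [r = m/n], the monomial [u^i t^{ir} t^k] is [u^i s^{nk + mi}], and
    [nk + mi] is [wt m n i k]. *)
Lemma coef_hmat_wt r x y (i : nat) k : 0 < r ->
  (coefL (hmat g r x y) (wt (numN r) (denN r) i k))`_i = coef (wronskG i x y) k.
Proof.
move=> r0; change (coefL (hmat g r x y)) with (coef (emb (hmat g r x y))).
rewrite hmatE lau_coef_sum coef_sum mxE lau_coef_sum; apply: eq_bigr => z _.
rewrite coef_ramL_sigmaL_wt ?numN_gt0 ?denN_gt0 // -emb_adj.
by rewrite !mxE.
Qed.

Lemma coef_hmat_nwt r x y (i : nat) j : 0 < r ->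
  (forall k, j != wt (numN r) (denN r) i k) -> (coefL (hmat g r x y) j)`_i = 0.
Proof.
move=> r0 hj; change (coefL (hmat g r x y)) with (coef (emb (hmat g r x y))).
rewrite hmatE lau_coef_sum coef_sum big1 // => z _.
by rewrite coef_ramL_sigmaL_nwt ?numN_gt0 ?denN_gt0.
Qed.

Lemma coef_res_pos r x y (i : nat) : 0 < r ->
  (res_pos g r x y)`_i = wcoef (numN r) (denN r) (wronskG i x y) i.
Proof.
move=> r0; rewrite mxE; case: (wtP (numN r) (denN r) i) => [[k ek]|h].
  by rewrite (wcoefE (denN_gt0 r) _ ek) -(coef_hmat_wt x y i k r0) ek.
by rewrite wcoef_ndiv ?denN_gt0 // coef_hmat_nwt // => k; rewrite eq_sym.
Qed.

Lemma good_wt r : 0 < r -> good g r <->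
  forall (i : nat) x y k, coef (wronskG i x y) k != 0 -> 0 <= wt (numN r) (denN r) i k.
Proof.
move=> r0; split=> [gr i x y k|h x y j j0].
  rewrite -(coef_hmat_wt _ _ _ _ r0) leNgt; apply: contraNN => /gr ->.
  by rewrite coef0.
apply/polyP => i; rewrite coef0.
case: (boolp.pselect (exists k, j = wt (numN r) (denN r) i k)) => [[k ek]|nk].
  rewrite ek coef_hmat_wt //; apply/eqP/contraT => /h; rewrite -ek; lia.
by rewrite coef_hmat_nwt // => k; apply/eqP => e; apply: nk; exists k.
Qed.

Lemma wt_rat r (i : nat) (k : int) : 0 < r ->
  (wt (numN r) (denN r) i k)%:~R = (denN r)%:R * (k%:~R + r * i%:R) :> rat.
Proof.
move=> r0; have n0 : (denN r)%:R != 0 :> rat by rewrite pnatr_eq0 -lt0n denN_gt0.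
have e : r = (numN r)%:R / (denN r)%:R.
  rewrite -[LHS]divq_num_den /numN /denN -[in LHS](gez0_abs (denq_ge0 r)).
  by rewrite -[in LHS](gtz0_abs (m := numq r)) // numq_gt0.
move: e n0; move: (numN r) (denN r) => m n -> n0.
by rewrite /wt rmorphD !rmorphM /= -!pmulrn; field.
Qed.

Lemma goodP r : 0 < r -> good g r <->
  forall (i : nat) x y k, coef (wronskG i x y) k != 0 -> 0 <= k%:~R + r * i%:R :> rat.
Proof.
move=> r0; rewrite good_wt //.
have e (i : nat) k : (0 <= wt (numN r) (denN r) i k) = (0 <= k%:~R + r * i%:R :> rat).
  by rewrite -(ler0z rat) wt_rat // pmulr_rge0 // ltr0n denN_gt0.
by split=> h i x y k /h; rewrite e.
Qed.

(** The conditions of [goodP] are closed in [r], so they pass to the infimum: a strict violation at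
    [q] would persist at good exponents slightly above [q]. *)
Lemma rindex_ge0 q : 0 <= q -> rindex g q ->
  forall (i : nat) x y k, coef (wronskG i x y) k != 0 -> 0 <= k%:~R + q * i%:R :> rat.
Proof.
move=> q0 [_ [_ hq]] i x y k nz; rewrite leNgt; apply/negP => lt0.
set s := k%:~R + q * i%:R in lt0.
have i1 : 0 < i%:R + 1 :> rat by rewrite ltr_wpDl ?ler0n.
(* At this bound the value is [s / (i + 1)], still negative. Dividing by [i + 1] rather than [i]
   also covers [i = 0]. *)
have [|r [r0 /(goodP r0) /(_ _ _ _ _ nz) ge0 rq]] := hq (q - s / (i%:R + 1)).
  by rewrite ltrDl oppr_gt0 pmulr_llt0 ?invr_gt0.
have : r * i%:R <= (q - s / (i%:R + 1)) * i%:R by rewrite ler_wpM2r ?ler0n // ltW.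
have e : k%:~R + (q - s / (i%:R + 1)) * i%:R = s / (i%:R + 1).
  by rewrite /s; field; rewrite lt0r_neq0.
move=> le; have : 0 <= s / (i%:R + 1) by rewrite -e (le_trans ge0) // lerD2l.
by rewrite leNgt pmulr_llt0 ?invr_gt0 // lt0.
Qed.

End Hmat.

(** * Positive index *)

(** By the binomial theorem only the power [a + b] of the sum of the variables contributes; [a] is
    the exponent of the outer variable, [b] that of the inner one. *)
Lemma coef_comp_XDpolyC (A : comNzRingType) (q : {poly A}) a b :
  ((map_poly polyC q) \Po ('X + ('X)%:P))`_a`_b = q`_(a + b) *+ 'C(a + b, a).
Proof.
rewrite comp_polyE size_map_polyC.
have e i : ((map_poly polyC q)`_i *: ('X + ('X)%:P) ^+ i)`_a`_b
    = if i == (a + b)%N then q`_i *+ 'C(i, a) else 0.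
  rewrite coef_map /= coefZ coefCM exprDn coef_sum.
  have [ia|ai] := ltnP i a.
    rewrite big1 => [|j _]; first by rewrite coef0 mulr0 ltn_eqF //; lia.
    rewrite -rmorphXn /= coefMn coefMC coefXn eqn_leq.
    by rewrite (leqNgt a) (leq_ltn_trans _ ia) ?leq_subr //= mul0r mul0rn.
  rewrite (bigD1 (Ordinal (leq_ltn_trans (leq_subr a i) (ltnSn i)))) //= big1 => [|j nj].
    rewrite addr0 subKn // -rmorphXn /= coefMn coefMC coefXn eqxx mul1r coefMn coefXn.
    rewrite bin_sub // mulrnAr (_ : (b == i - a)%N = (i == a + b)%N); last by lia.
    by case: eqP => _; rewrite ?mulr1 // mulr0 mul0rn.
  rewrite -rmorphXn /= coefMn coefMC coefXn; case: eqP => [ea|_]; last by rewrite mul0r mul0rn.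
  case/negP: nj; apply/eqP/val_inj => /=; have := ltn_ord j; lia.
rewrite !coef_sum (eq_bigr _ (fun (i : 'I_(size q)) _ => e i)).
have [lt|ge] := ltnP (a + b) (size q).
  rewrite (bigD1 (Ordinal lt)) //= eqxx big1 ?addr0 // => i ni.
  by rewrite ifF //; apply: contraNF ni => /eqP e'; apply/eqP/val_inj.
rewrite (nth_default _ ge) mul0rn big1 // => i _.
by rewrite ifF //; apply/eqP; have := ltn_ord i; lia.
Qed.

(** Turns goodness at [m/n - 1/(nM)] into an integer inequality: lowering the exponent costs [i],
    while each unit of weight counts [M]. *)
Lemma wt_shift (m n M i : nat) (k : int) : (0 < n)%N -> (0 < M)%N ->
  (n * M)%N%:R * (k%:~R + (m%:R / n%:R - (n * M)%N%:R^-1) * i%:R) =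
  (M%:Z * wt m n i k - i%:Z)%:~R :> rat.
Proof.
rewrite -!(ltr0n rat) => /lt0r_neq0 n0 /lt0r_neq0 M0.
rewrite /wt natrM rmorphB rmorphM rmorphD !rmorphM /= -!pmulrn.
by field; rewrite n0 M0.
Qed.

Section Positive.
Variables (A : comNzRingType) (N : nat) (I : {mpoly A[N * N]} -> Prop).
Hypothesis hG : closed_subgroup_SL I.
Variable g : 'M[lser A]_N.
Hypothesis hg : ptsGL I g.

Let G : 'M[lau A^o]_N := embM g.
Let H : 'M[lau A^o]_N := \adj G.

Lemma embM_det : \det G = 1.
Proof. by case: hG => hdet _; apply: ptsG_det hdet (emb_ptsG hg). Qed.

Lemma embM_mul_adj : G *m H = 1%:M.
Proof. by rewrite mul_mx_adj embM_det. Qed.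

Lemma embM_adj_mul : H *m G = 1%:M.
Proof. by rewrite mul_adj_mx embM_det. Qed.

Lemma adj_ptsG : ptsG I H.
Proof. by case: hG => _ /(_ (lau A^o)) [_ _]; apply; apply: emb_ptsG. Qed.

Lemma wronsk_ser_ptsG : ptsG I (wronsk_ser G H : 'M[lau (lau A^o)]_N).
Proof.
case: hG => _ /(_ (lau (lau A^o))) [_ hM _]; apply: hM.
- apply: ptsG_map adj_ptsG => [a|x y|x y].
  + by apply: lau_eqP => i; rewrite lau_coef_alg.
  + by rewrite mono_add.
  + by rewrite mono_mul addr0.
- apply: ptsG_map (emb_ptsG hg) => [a|x y|x y].
  + apply: lau_eqP => i; apply: lau_eqP => k; rewrite coef_taylor !subr0 !lau_coef_alg.
    case: (eqVneq i 0) => [->|ni]; first by rewrite [binZ _ _](binz0 k) lau_coef_alg.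
    case: (eqVneq k 0) => [->|_]; last by rewrite mul0rz.
    by case: i ni => [[|i]|i].
  + exact: taylorD.
  + exact: taylorM.
Qed.

Section Res.
Variable r : rat.
Hypotheses (r0 : 0 < r) (hr : rindex g r).
Let m := numN r.
Let n := denN r.
Let m_gt0 : (0 < m)%N := numN_gt0 r0.
Let n_gt0 : (0 < n)%N := denN_gt0 r.

Lemma rindex_wt (i : nat) x y k : coef (wronskG g i x y) k != 0 -> 0 <= wt m n i k.
Proof.
move=> /(rindex_ge0 (ltW r0) hr); rewrite -(ler0z rat) wt_rat //.
by rewrite pmulr_rge0 // ltr0n denN_gt0.
Qed.

Lemma wrel_wronsk_ser x y : wrel m n (wronsk_ser G H x y) (res_pos g r x y).
Proof.
split=> [i i0|i k|i]; first exact: coef_wronsk_ser_lt.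
  by rewrite coef_wronsk_ser; apply: rindex_wt.
by rewrite coef_res_pos // coef_wronsk_ser.
Qed.

Lemma res_pos_ptsG : ptsG I (res_pos g r).
Proof.
apply: (ptsG_alg_rel (wrel_alg m n_gt0 A)) wronsk_ser_ptsG.
  move=> q [_ _ hq]; apply/polyP => i.
  by rewrite hq wcoef0 coef0.
exact: wrel_wronsk_ser.
Qed.

(** The part of weight 0 of the composition law, read at [u^(a+b)]. Additivity of the residue is
    this identity for all [a] and [b]. *)
Lemma res_pos_comul x y a b :
  (res_pos g r x y)`_(a + b) *+ 'C(a + b, a) =
  \sum_z (res_pos g r x z)`_b * (res_pos g r z y)`_a.
Proof.
pose Z := wronsk_ser G H *m map_mx (taylor a) (wronsk G H a).
(* By [wrel_taylor], the part of weight 0 of [taylor a (W_a)]. *)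
pose T : 'M[{poly A}]_N := \matrix_(z, y) (((res_pos g r z y)`_a)%:P * 'X^a).
have [_ _ /(_ (a + b)%N)] : wrel m n (Z x y) ((res_pos g r *m T) x y).
  apply: (alg_rel_mulmx (wrel_alg m n_gt0 A)) => [|z y']; first exact: wrel_wronsk_ser.
  rewrite [map_mx _ _ _ _]mxE [T _ _]mxE coef_res_pos //.
  by apply: wrel_taylor => // k; apply: rindex_wt.
rewrite /Z wronsk_ser_taylor ?embM_mul_adj ?embM_adj_mul //.
have wMn (f : lau A^o) k : wcoef m n (f *+ k) (a + b) = wcoef m n f (a + b) *+ k.
  by elim: k => [|k ih]; rewrite ?mulr0n ?wcoef0 // !mulrS wcoefD ih.
rewrite wMn -coef_res_pos // => <-; rewrite mxE coef_sum; apply: eq_bigr => z _.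
by rewrite [T _ _]mxE mulrA coefMXn ltnNge leq_addr /= addKn coefMC.
Qed.

Lemma res_pos_Ga_hom : Ga_hom I (res_pos g r).
Proof.
split; first exact: res_pos_ptsG.
apply/matrixP => x y; apply/polyP => a; apply/polyP => b.
rewrite mxE coef_comp_XDpolyC res_pos_comul [in RHS]mxE !coef_sum.
by apply: eq_bigr => z _; rewrite [map_mx _ _ _ _]mxE [map_mx _ _ z y]mxE coefCM coef_map /= coefMC.
Qed.

(* If all positive-degree coefficients of the residue vanished, the index could
   be lowered to [r - 1/(nM)], where [- C] bounds all valuations from below. *)
Lemma res_pos_nontriv : res_pos g r <> 1%:M.
Proof.
move=> triv; have [c hc] := wronsk_bounded G H.
(* [M] must make [M wt - i] nonnegative for every monomial that occurs with [i > M], where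
   [wt >= i - nC]. The summand 2 also gives [M m > 1], hence [r' > 0]. *)
pose C := absz c; pose M := (n * C + 2)%N.
have wt_gt0 (i : nat) x y k : (0 < i)%N -> coef (wronskG g i x y) k != 0 -> 0 < wt m n i k.
  move=> i0 nz; rewrite lt_def (rindex_wt nz) andbT; apply: contraNN nz => /eqP e.
  have := congr1 (fun X : 'M[{poly A}]_N => (X x y)`_i) triv.
  rewrite coef_res_pos // (wcoefE n_gt0 _ e) => ->.
  by rewrite mxE coefMn coef1 (gtn_eqF i0) mul0rn.
have rE : r = m%:R / n%:R.
  have := wt_rat 1 0 r0; rewrite /wt -/m -/n => /eqP; rewrite mulr0 add0r mulr1 add0r mulr1.
  rewrite mulrC -pmulrn => /eqP ->; rewrite mulfK // pnatr_eq0; lia.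
pose r' : rat := r - (n * M)%N%:R^-1.
have nM0 : 0 < (n * M)%N%:R :> rat by rewrite ltr0n /M; nia.
have n0 : (n%:R != 0 :> rat) by rewrite pnatr_eq0; lia.
have scale (i : nat) (k : int) : (n * M)%N%:R * (k%:~R + r' * i%:R) =
    (M%:Z * wt m n i k - i%:Z)%:~R :> rat.
  by rewrite /r' rE wt_shift //; lia.
have r'0 : 0 < r'.
  have := scale 1%N 0; rewrite add0r mulr1 => e.
  rewrite -(pmulr_rgt0 _ nM0) e ltr0z /wt /M; nia.
have : good g r'.
  apply/(goodP _ r'0) => i x y k nz.
  rewrite -(pmulr_rge0 _ nM0) scale ler0z.
  case: (posnP i) => [i0|i0].
    have := rindex_wt nz; rewrite i0 => h; nia.
  have h1 := wt_gt0 _ _ _ _ i0 nz.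
  have h2 : c <= k by rewrite leNgt; apply: contraNN nz => /hc->.
  (* For [0 < i <= M] the weight is a positive integer, so [M wt >= M >= i]. For [i > M] the uniform
     degree bound takes over. *)
  have [iM|Mi] := leqP i M; first by nia.
  have h3 : - (n * C)%N%:Z <= n%:Z * k by rewrite /C; nia.
  have h4 : (M + 1)%N%:Z <= i%:Z by lia.
  have h5 : i%:Z <= m%:Z * i%:Z by nia.
  have h6 : (n * C)%N%:Z = M%:Z - 2 by rewrite /M; lia.
  rewrite /wt; nia.
case: hr => _ [h _] /(h _ r'0); rewrite leNgt => /negP; apply.
by rewrite ltrBlDr ltrDl invr_gt0.
Qed.

End Res.
End Positive.

(** * Index zero *)

(** By Vandermonde the hypothesis also holds for [binom(k - a, i)], where the relevant upper indices
    are natural numbers. The system is then triangular: for [i = k - a] the degrees below [k] drop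
    out, and descending induction from [b] kills those above. *)
Lemma binz_indep (V : zmodType) (F : int -> V) (a b : int) :
  (forall k, k < a -> F k = 0) -> (forall k, b < k -> F k = 0) ->
  (forall i, tsum (fun k => F k *~ binz k i) = 0) -> forall k, F k = 0.
Proof.
move=> Fa Fb Fi.
have Fsupp : fin_supp F by apply: fin_supp_itv Fa Fb.
have shifted (i : nat) : tsum (fun k => F k *~ binz (k - a) i) = 0.
  transitivity (tsum (fun k => tsum (fun c => F k *~ (binZ k c * binZ (- a) (i%:Z - c))))).
    apply: eq_tsum => k; rewrite -[binz _ _]/(binZ (k - a) i) -binZ_vandermonde.
    rewrite (raddf_tsum (f := fun n : int => F k *~ n)) //; first exact: mulrzDr.
    apply: (@fin_supp_itv _ _ 0 i) => c hc; first by rewrite binZ_lt0 ?mul0r.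
    by rewrite mulrC binZ_lt0 ?mul0r //; lia.
  rewrite (@exchange_tsum _ _ (zitv a b) (zitv 0 i)); last first.
    move=> k c nz; rewrite !mem_zitv.
    have : a <= k by rewrite leNgt; apply: contraNN nz => /Fa->; rewrite mul0rz.
    have : k <= b by rewrite leNgt; apply: contraNN nz => /Fb->; rewrite mul0rz.
    have : 0 <= c by rewrite leNgt; apply: contraNN nz => /binZ_lt0->; rewrite mul0r mulr0z.
    have : 0 <= i%:Z - c.
      by rewrite leNgt; apply: contraNN nz => /binZ_lt0->; rewrite mulr0 mulr0z.
    lia.
  apply: tsum0 => -[c|c]; last by rewrite tsum0 // => k; rewrite mul0r mulr0z.
  transitivity (tsum (fun k => F k *~ binz k c) *~ binZ (- a) (i%:Z - c%:Z)).
    rewrite (raddf_tsum (f := fun x => x *~ binZ (- a) (i%:Z - c%:Z))).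
    - by apply: eq_tsum => k; rewrite -mulrzA.
    - exact: mul0rz.
    - by move=> x y; rewrite mulrzDl.
    - by apply: (fin_supp_raddf (f := fun k x => x *~ binz k c)) => // k; rewrite mul0rz.
  by rewrite Fi mul0rz.
suff top (d : nat) : forall k, b - d%:Z < k -> F k = 0.
  by move=> k; apply: (top (absz (b - k)%R).+1); lia.
elim: d => [|d ih] k hk; first by apply: Fb; lia.
case: (ltP k a) => [/Fa //|ak]; case: (ltP (b - d%:Z) k) => [/ih //|kb].
have := shifted (absz (k - a)%R); rewrite (@tsum1 _ _ k) => [|k' nk].
  have -> : k - a = absz (k - a)%R :> int by lia.
  by rewrite /= binn.
case: (ltP k k') => kk'; first by rewrite ih ?mul0rz //; lia.
case: (ltP k' a) => k'a; first by rewrite Fa ?mul0rz.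
have -> : k' - a = absz (k' - a)%R :> int by lia.
by rewrite /= bin_small ?mulr0z //; lia.
Qed.

Lemma coef_mulmx (B : comNzRingType) (m n p : nat)
    (X : 'M[lau B]_(m, n)) (Y : 'M[lau B]_(n, p)) x y j :
  coef ((X *m Y) x y) j =
  tsum (fun k => \sum_z coef (X x z) (j - k) * coef (Y z y) k).
Proof.
have e z : coef (X x z * Y z y) j = tsum (fun k => coef (X x z) (j - k) * coef (Y z y) k).
  by rewrite mulrC lau_coefM; apply: eq_tsum => k; rewrite mulrC.
rewrite mxE lau_coef_sum (eq_bigr _ (fun z _ => e z)) tsum_sum // => z.
have [s hs] := conv_fin_supp (Y z y) (X x z) j.
by exists s => k; rewrite mulrC; apply: hs.
Qed.

Lemma map_mx_mul_morph (R S : pzRingType) (phi : R -> S) (m n p : nat)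
    (X : 'M[R]_(m, n)) (Y : 'M[R]_(n, p)) :
  phi 0 = 0 -> {morph phi : x y / x + y} -> {morph phi : x y / x * y} ->
  map_mx phi (X *m Y) = map_mx phi X *m map_mx phi Y.
Proof.
move=> p0 pD pM; apply/matrixP => x y; rewrite !mxE (big_morph phi pD p0).
by apply: eq_bigr => z _; rewrite pM !mxE.
Qed.

(** * The substitution [t |-> x t], base change and specialization *)

Section PowZ.
Variables (R : comNzRingType) (x xi : R).
Hypothesis xK : x * xi = 1.

Lemma powZS k : powZ x xi (k + 1) = powZ x xi k * x.
Proof.
case: k => [p|[|p]].
- by rewrite -PoszD addn1 /= exprSr.
- have -> : Negz 0 + 1 = 0 :> int by [].
  by rewrite /= expr1 mulrC xK.
- have -> : Negz p.+1 + 1 = Negz p by lia.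
  by rewrite /= [xi ^+ p.+2]exprSr -mulrA [xi * x]mulrC xK mulr1.
Qed.

Lemma powZD k l : powZ x xi (k + l) = powZ x xi k * powZ x xi l.
Proof.
elim/int_ind: l => [|n ih|n ih]; first by rewrite addr0 mulr1.
  have -> : k + n.+1%:Z = k + n%:Z + 1 by lia.
  have -> : n.+1%:Z = n%:Z + 1 by lia.
  by rewrite !powZS ih mulrA.
have inj a b : a * x = b * x -> a = b.
  by move=> /(congr1 ( *%R^~ xi)); rewrite -!mulrA xK !mulr1.
apply: inj; rewrite -mulrA -!powZS.
have -> : k - n.+1%:Z + 1 = k - n%:Z by lia.
by have -> : - n.+1%:Z + 1 = - n%:Z by lia.
Qed.

Lemma twist_bounded (f : lau R) : bounded (fun k => coef f k * powZ x xi k).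
Proof. by case: (coef_bounded f) => v hv; exists v => k /hv ->; rewrite mul0r. Qed.
Definition twist (f : lau R) : lau R := Lau (twist_bounded f).

Lemma coef_twist f k : coef (twist f) k = coef f k * powZ x xi k. Proof. by []. Qed.

Lemma twist0 : twist 0 = 0.
Proof. by apply: lau_eqP => k /=; rewrite mul0r. Qed.

Lemma twistD : {morph twist : f g / f + g}.
Proof. by move=> f g; apply: lau_eqP => k /=; rewrite mulrDl. Qed.

Lemma twistM : {morph twist : f g / f * g}.
Proof.
move=> f g; apply: lau_eqP => j; rewrite [LHS]/= [RHS]lau_coefM.
rewrite (raddf_tsum (f := fun a => a * powZ x xi j)).
- apply: eq_tsum => k /=; rewrite [RHS]mulrACA -powZD.
  by have -> : k + (j - k) = j by lia.
- exact: mul0r.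
- by move=> a b; rewrite mulrDl.
- exact: conv_fin_supp.
Qed.

Lemma twist1 : twist 1 = 1.
Proof.
by apply: lau_eqP => k; rewrite /= /monoF; case: eqP => [->|]; rewrite ?mulr1 ?mul0r.
Qed.

End PowZ.

Lemma powZM (R : comNzRingType) (x xi y yi : R) k :
  powZ (x * y) (xi * yi) k = powZ x xi k * powZ y yi k.
Proof. by case: k => p /=; rewrite exprMn. Qed.

Section BaseChange.
Variables (A : comNzRingType) (R : comAlgType A).

Lemma base_bounded (f : lau A^o) : bounded (fun k => (coef f k : A)%:A : R).
Proof. by case: (coef_bounded f) => v hv; exists v => k /hv ->; rewrite scale0r. Qed.
Definition base (f : lau A^o) : lau R := Lau (base_bounded f).

Lemma coef_base f k : coef (base f) k = (coef f k : A)%:A. Proof. by []. Qed.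

Lemma base0 : base 0 = 0.
Proof. by apply: lau_eqP => k /=; rewrite scale0r. Qed.

Lemma baseD : {morph base : f g / f + g}.
Proof. by move=> f g; apply: lau_eqP => k /=; rewrite scalerDl. Qed.

Lemma baseM : {morph base : f g / f * g}.
Proof.
move=> f g; apply: lau_eqP => j; rewrite [LHS]/= [RHS]lau_coefM.
rewrite (raddf_tsum (f := fun a : A => a%:A : R)).
- by apply: eq_tsum => k /=; rewrite -scalerAl mul1r scalerA.
- exact: scale0r.
- by move=> a b; rewrite scalerDl.
- exact: conv_fin_supp.
Qed.

Lemma base_alg (a : A) : base a%:A = a%:A.
Proof.
apply: lau_eqP => k; rewrite coef_base !lau_coef_alg.
by case: eqP => _; rewrite ?scale0r // [_ *: 1 : A^o]/GRing.scale /= mulr1.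
Qed.

(** The graph of [j : t |-> 0], which is defined on integral series only. *)
Definition spec0 (X : lau R) (a : R) : Prop :=
  (forall k, k < 0 -> coef X k = 0) /\ coef X 0 = a.

Lemma alg_rel_spec0 : alg_rel spec0.
Proof.
split=> [a|X Y a b [X0 Xa] [Y0 Yb]|X Y a b [X0 Xa] [Y0 Yb]].
- by split=> [k k0|]; rewrite lau_coef_alg // lt_eqF.
- split=> [k k0|]; last by rewrite lau_coefD Xa Yb.
  by rewrite lau_coefD X0 ?Y0 ?addr0.
- split=> [k k0|].
    rewrite lau_coefM tsum0 // => l; case: (ltP l 0) => hl; first by rewrite X0 ?mul0r.
    by rewrite Y0 ?mulr0 //; lia.
  rewrite lau_coefM (@tsum1 _ _ 0) ?subr0 ?Xa ?Yb // => l nl.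
  case: (ltP l 0) => hl; first by rewrite X0 ?mul0r.
  by rewrite Y0 ?mulr0 //; lia.
Qed.

End BaseChange.

(** * The residue at index zero *)

Section Zero.
Variables (A : comNzRingType) (N : nat) (I : {mpoly A[N * N]} -> Prop).
Hypothesis hG : closed_subgroup_SL I.
Variable g : 'M[lser A]_N.
Hypothesis hg : ptsGL I g.
Hypothesis hr : rindex g 0.

Let G : 'M[lau A^o]_N := embM g.
Let H : 'M[lau A^o]_N := \adj G.

(* Coefficient of [t^j lambda^k] in [g^{-1} sigma_0(g)]. *)
Definition bicoef (j k : int) : 'M[A^o]_N :=
  \matrix_(x, y) \sum_z coef (H x z) (j - k) * coef (G z y) k.

Lemma bicoef_bounds j x y : exists a b : int,
  (forall k, k < a -> bicoef j k x y = 0) /\ (forall k, b < k -> bicoef j k x y = 0).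
Proof.
have [a ha] := bounded_fin (fun z => coef_bounded (G z y)).
have [c hc] := bounded_fin (fun z => coef_bounded (H x z)).
exists a, (j - c); split=> k hk; rewrite mxE big1 // => z _.
  by rewrite ha ?mulr0.
by rewrite hc ?mul0r //; lia.
Qed.

(** The coefficient of [t^j] in [W_i] is the sum over [k] of [binom(k, i)] times [bicoef j k]. Index
    0 makes every [W_i] integral, so these sums vanish for all [i] and [binz_indep] applies. *)
Lemma bicoef_neg j k : j < 0 -> bicoef j k = 0.
Proof.
move=> j0; apply/matrixP => x y; rewrite [RHS]mxE.
have [a [b [ha hb]]] := bicoef_bounds j x y.
apply: (binz_indep ha hb) => i.
transitivity (coef (wronskG g i x y) j).
  rewrite coef_mulmx; apply: eq_tsum => l; rewrite mxE mulrz_suml.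
  by apply: eq_bigr => z _; rewrite [map_mx (hasse i) _ _ _]mxE /= mulrzAr.
apply/eqP/contraT => /(rindex_ge0 (lexx 0) hr).
by rewrite mul0r addr0 ler0z leNgt j0.
Qed.

Section Points.
Variable R : comAlgType A.

(** The value of [g^{-1} sigma_0(g)] at [lambda = x], over [R]. *)
Definition hmat0 (x xi : R) : 'M[lau R]_N :=
  map_mx (@base A R) H *m map_mx (twist x xi) (map_mx (@base A R) G).

Lemma coef_hmat0 (x xi : R) i j e : coef (hmat0 x xi i j) e =
  tsum (fun k => (bicoef e k i j : A)%:A * powZ x xi k).
Proof.
rewrite coef_mulmx; apply: eq_tsum => k; rewrite mxE scaler_suml mulr_suml.
by apply: eq_bigr => z _; rewrite !mxE /= mulrA -scalerAl mul1r scalerA.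
Qed.

Lemma res0E (x xi : R) i j : res0 g x xi i j = coef (hmat0 x xi i j) 0.
Proof.
rewrite mxE.
set M := mulML _ _; change (coefL (M i j) 0) with (coef (emb (M i j)) 0).
have -> : emb (M i j) = (map_mx (@emb R) M) i j by rewrite [RHS]mxE.
rewrite /M emb_mulM; congr (coef ((_ *m _) i j) 0); apply/matrixP => a b.
  rewrite /H /G -emb_adj !mxE; apply: lau_eqP => k; rewrite /= /coefL /=.
  by case: (k - _) => // l; rewrite scale0r.
rewrite !mxE; apply: lau_eqP => k; rewrite /= /coefL /=.
case e : (k - _) => [l|l]; last by rewrite scale0r mul0r.
by congr (_ * powZ _ _ _); lia.
Qed.

Lemma hmat0_spec0 (x xi : R) i j : spec0 (hmat0 x xi i j) (res0 g x xi i j).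
Proof.
split=> [k k0|]; last by rewrite res0E.
rewrite coef_hmat0 tsum0 // => l; rewrite bicoef_neg // mxE.
by rewrite [_ *: _]scale0r mul0r.
Qed.

Lemma hmat0_ptsG (x xi : R) : x * xi = 1 -> ptsG I (hmat0 x xi).
Proof.
move=> xK; case: hG => _ /(_ (lau R)) [_ hM _]; apply: hM.
  by apply: ptsG_map (adj_ptsG hG hg); [exact: base_alg | exact: baseD | exact: baseM].
apply: ptsG_map; [|exact: twistD|exact: twistM|].
  move=> a; apply: lau_eqP => k; rewrite coef_twist !lau_coef_alg.
  by case: eqP => [->|]; rewrite ?mulr1 ?mul0r.
by apply: ptsG_map (emb_ptsG hg); [exact: base_alg | exact: baseD | exact: baseM].
Qed.

Lemma res0_ptsG (x xi : R) : x * xi = 1 -> ptsG I (res0 g x xi).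
Proof.
move=> /hmat0_ptsG; apply: (ptsG_alg_rel (alg_rel_spec0 R)) => [s [_ <-] //|].
exact: hmat0_spec0.
Qed.

(** The cocycle identity: substituting [xy] is substituting [y], then [x], and the product
    [sigma_x(g) sigma_x(g^{-1}) = 1] is inserted in the middle. *)
Lemma hmat0M (x xi y yi : R) : x * xi = 1 -> y * yi = 1 ->
  hmat0 (x * y) (xi * yi) = hmat0 x xi *m map_mx (twist x xi) (hmat0 y yi).
Proof.
move=> xK yK; rewrite /hmat0.
rewrite [in RHS](map_mx_mul_morph _ _ (twist0 x xi) (twistD x xi) (twistM xK)).
rewrite -!mulmxA; congr (_ *m _); rewrite mulmxA.
rewrite -(map_mx_mul_morph _ _ (twist0 x xi) (twistD x xi) (twistM xK)).
rewrite -(map_mx_mul_morph _ _ (base0 R) (@baseD A R) (@baseM A R)).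
rewrite /H /G (embM_mul_adj hG hg).
have b1 : map_mx (twist x xi) (map_mx (@base A R) 1%:M) = 1%:M :> 'M[lau R]_N.
  apply/matrixP => i j; rewrite !mxE; case: (i == j); rewrite ?base0 ?twist0 //.
  have -> : @base A R 1 = 1 by have := base_alg R 1; rewrite !scale1r.
  by rewrite twist1.
rewrite b1 mul1mx; apply/matrixP => i j; rewrite !mxE; apply: lau_eqP => k /=.
by rewrite powZM -mulrA [powZ y yi k * _]mulrC.
Qed.

Lemma res0M (x xi y yi : R) : x * xi = 1 -> y * yi = 1 ->
  res0 g (x * y) (xi * yi) = res0 g x xi *m res0 g y yi.
Proof.
move=> xK yK; apply/matrixP => i j; rewrite res0E hmat0M //.
(* Twisting preserves integrality and the constant coefficient, so it disappears modulo [t]. *)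
apply: (alg_rel_mulmx (alg_rel_spec0 R) (hmat0_spec0 x xi) _ i j).2 => a b.
have [h1 h2] := hmat0_spec0 y yi a b; rewrite [map_mx _ _ _ _]mxE.
split=> [k k0|]; rewrite coef_twist; first by rewrite h1 ?mul0r.
by rewrite h2 mulr1.
Qed.

End Points.

(** The test point for non-triviality is [lambda = t] in [A((t))]: the coefficients of a Laurent
    polynomial in [lambda] can be read off from its value there. *)
Let T : lau A^o := mono 1 1.
Let Ti : lau A^o := mono 1 (-1).

Lemma mono_unit : T * Ti = 1.
Proof. by rewrite mono_mul mulr1 subrr. Qed.

Lemma powZ_mono k : powZ T Ti k = mono 1 k.
Proof.
have e (d : int) p : (mono 1 d : lau A^o) ^+ p = mono 1 (d * p%:Z).
  elim: p => [|p ih]; first by rewrite mulr0.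
  by rewrite exprS ih mono_mul mulr1; congr mono; rewrite -[p.+1]addn1 PoszD mulrDr mulr1 addrC.
by case: k => p; rewrite /= e; congr mono; lia.
Qed.

Lemma coef_res0_mono x y k : coef (res0 g T Ti x y) k = bicoef 0 k x y.
Proof.
have [a [b [ha hb]]] := bicoef_bounds 0 x y.
rewrite res0E coef_hmat0 (raddf_tsum (f := fun f : lau A^o => coef f k)) //; last first.
  by apply: (fin_supp_itv (a := a) (b := b)) => l hl; [rewrite ha | rewrite hb];
    rewrite // [_ *: _]scale0r mul0r.
rewrite (@tsum1 _ _ k) => [|l nl].
  rewrite powZ_mono mulrC lau_coefMmono mul1r subrr lau_coef_alg eqxx.
  by rewrite [LHS]/GRing.scale /= mulr1.
rewrite powZ_mono mulrC lau_coefMmono mul1r lau_coef_alg subr_eq0 eq_sym.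
by rewrite (negPf nl).
Qed.

(* With trivial residue, the coefficients of [g] of negative degree vanish by
   increasing induction: in [g_k = \sum_p g_(-p) (h_p g_k)] every term is zero. *)
Lemma res0_nontriv : res0 g T Ti <> 1%:M.
Proof.
move=> triv.
have bi0 k : k != 0 -> bicoef 0 k = 0.
  move=> k0; apply/matrixP => x y; rewrite -coef_res0_mono triv !mxE.
  by case: (x == y) => //=; rewrite /monoF (negPf k0).
have [c hc] := bounded_fin (fun z : 'I_N * 'I_N => coef_bounded (G z.1 z.2)).
case: hr => nint _; apply: nint => x0 y0 e0 e0_lt0.
suff ind (d : nat) : forall k x y, k < 0 -> k < c + d%:Z -> coef (G x y) k = 0.
  have := ind (absz (e0 - c)%R).+1 e0 x0 y0 e0_lt0.
  by rewrite /G !mxE /=; apply; lia.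
elim: d => [|d ih] k x y k0 kc; first by apply: (hc (x, y)); lia.
case: (ltP k (c + d%:Z)) => [/ih -> //|ck].
(* The constant coefficient of [G H = 1] is inserted on the left, in order to regroup its factor [H]
   with [G] into [bicoef]. *)
have -> : coef (G x y) k = \sum_z coef ((G *m H) x z) 0 * coef (G z y) k.
  rewrite (embM_mul_adj hG hg) (bigD1 x) //= big1 => [|z nz].
    by rewrite addr0 [1%:M _ _]mxE eqxx lau_coef1 eqxx mul1r.
  by rewrite [1%:M _ _]mxE eq_sym (negPf nz) lau_coef0 mul0r.
have e z : coef ((G *m H) x z) 0 * coef (G z y) k =
    tsum (fun p => (\sum_w coef (G x w) (0 - p) * coef (H w z) p) * coef (G z y) k).
  rewrite coef_mulmx (raddf_tsum (f := fun a => a * coef (G z y) k)) ?mul0r //.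
    by move=> a b; rewrite mulrDl.
  apply: fin_supp_sum => w; apply: (fin_supp_conv (coef_bounded (H w z)) (coef_bounded (G x w))
    (j := 0)) => p ->; by rewrite ?mulr0 ?mul0r.
have fs z : fin_supp (fun p => (\sum_w coef (G x w) (0 - p) * coef (H w z) p) * coef (G z y) k).
  apply: (fin_supp_raddf (f := fun _ a => a * coef (G z y) k)); first by move=> _; rewrite mul0r.
  apply: fin_supp_sum => w; apply: (fin_supp_conv (coef_bounded (H w z)) (coef_bounded (G x w))
    (j := 0)) => p ->; by rewrite ?mulr0 ?mul0r.
rewrite (eq_bigr _ (fun z _ => e z)) -tsum_sum // tsum0 // => p.
transitivity (\sum_w coef (G x w) (0 - p) * bicoef (p + k) k w y).
  under eq_bigr do rewrite mulr_suml.
  rewrite exchange_big; apply: eq_bigr => w _ /=.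
  rewrite [bicoef _ _ _ _]mxE mulr_sumr; apply: eq_bigr => z _.
  by rewrite addrK mulrA.
(* If [-p < k], the coefficient of [G] vanishes by induction. If [p + k < 0], integrality applies.
   There remains [p + k = 0], where triviality kills the term since [k] is nonzero. *)
apply: big1 => w _; case: (ltP (0 - p) k) => pk; first by rewrite ih ?mul0r //; lia.
case: (ltP (p + k) 0) => pk0; first by rewrite bicoef_neg // [X in _ * X]mxE mulr0.
have -> : p + k = 0 by lia.
by rewrite bi0 ?lt_eqF // [X in _ * X]mxE mulr0.
Qed.

Lemma res0_Gm_hom_nontriv : Gm_hom_nontriv I g.
Proof.
split; [exact: res0_ptsG | exact: res0M |].
by exists (lau A^o), T, Ti; split; [exact: mono_unit | exact: res0_nontriv].
Qed.

End Zero.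

Theorem mainTheorem2 (A : comNzRingType) (N : nat)
    (I : {mpoly A[N * N]} -> Prop) (hG : closed_subgroup_SL I)
    (g : 'M[lser A]_N) (hg : ptsGL I g) :
  (forall r : rat, 0 < r -> rindex g r ->
     Ga_hom I (res_pos g r) /\ res_pos g r <> 1%:M) /\
  (rindex g 0 -> Gm_hom_nontriv I g).
Proof.
split=> [r r0 hr|hr]; last exact: res0_Gm_hom_nontriv.
split; [exact: res_pos_Ga_hom | exact: res_pos_nontriv].
Qed.
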